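(* Let $T:X\to X$ be a homeomorphism of a compact metric space $(X,d)$ with the specification property, let $\tau:X\to(0,\infty)$ be a continuous roof function, and let $(X_\tau,\Theta)$ be the corresponding suspension flow. Let $\Phi,H\in C(X_\tau)$ with $\inf_{\nu\in\mathcal{M}_\Theta}\int\Phi\,d\nu<\sup_{\nu\in\mathcal{M}_\Theta}\int\Phi\,d\nu$. Then $$\sup\Big\{\int H\,d\nu:\nu\in\mathcal{M}_\Theta\Big\}=\sup\Big\{\int H\,d\nu:\nu\in\bigcup_{(x,s)\in\widehat{X}_\Phi}\mathcal{V}((x,s))\Big\}=\sup_{(x,s)\in\widehat{X}_\Phi}\limsup_{t\to\infty}\frac1t\int_0^t H(\theta_u(x,s))\,du.$$
   Context: $(X,T)$ has the specification property if for every $\epsilon>0$ there is an integer $m(\epsilon)$ such that for any finite collection of intervals $[a_j,b_j]\subset\mathbb{N}$, $j=1,\dots,k$, with $a_{j+1}-b_j\ge m(\epsilon)$ for $j=1,\dots,k-1$, and any $x_1,\dots,x_k\in X$, there is $x\in X$ with $d(T^{p+a_j}x,T^px_j)<\epsilon$ for all $p=0,\dots,b_j-a_j$ and all $j$. The suspension space is $X_\tau=\{(x,s)\in X\times\mathbb{R}:0\le s\le\tau(x)\}$ with $(x,\tau(x))$ identified with $(Tx,0)$, equipped with the Bowen–Walters metric (making it compact); the suspension flow is $\theta_t(x,s)=(x,s+t)$ (with the identification). $\mathcal{M}_\Theta$ is the set of Borel probability measures on $X_\tau$ invariant under all $\theta_t$, $t\ge0$. $\widehat{X}_\Phi=\{(x,s)\in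 X_\tau:\lim_{t\to\infty}\frac1t\int_0^t\Phi(\theta_u(x,s))\,du\text{ does not exist}\}$. For $(x,s)\in X_\tau$, $\mathcal{V}((x,s))$ is the set of weak$^*$ limit points as $t\to\infty$ of $\delta_{(x,s),t}=\frac1t\int_0^t\delta_{\theta_u(x,s)}\,du$. *)

(* Defs.v *)
From HB Require Import structures.
From mathcomp Require Import all_boot all_order all_algebra.
From mathcomp Require Import generic_quotient.
From mathcomp Require Import all_classical all_reals all_analysis.
Unset Printing Implicit Defensive.
Import Order.TTheory GRing.Theory Num.Theory.
Import numFieldTopology.Exports.
Local Open Scope classical_set_scope.
Local Open Scope ring_scope.
Local Open Scope quotient_scope.

#[short(type="pmetricType")]
HB.structure Definition PointedMetric (K : numDomainType) :=
  { M of Pointed M & Metric K M }.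

Definition homeomorphism {R : realType} {X : pmetricType R} (T : X -> X) :=
  continuous T /\ exists Tinv : X -> X,
    [/\ continuous Tinv, cancel T Tinv & cancel Tinv T].

Definition specification {R : realType} {X : pmetricType R} (T : X -> X) :=
  forall eps : R, 0 < eps -> exists m : nat,
    forall (k : nat) (a b : nat -> nat) (xs : nat -> X),
      (forall j, (j < k)%N -> (a j <= b j)%N) ->
      (forall j, (j.+1 < k)%N -> (b j + m <= a j.+1)%N) ->
      exists x : X, forall j, (j < k)%N ->
        forall p, (p <= b j - a j)%N ->
          mdist (iter (p + a j) T x) (iter p T (xs j)) < eps.

Definition birk {R : realType} {X : Type} (T : X -> X) (tau : X -> R)
  (n : nat) (x : X) : R := \sum_(k < n) tau (iter k T x).

Definition Ydom {R : realType} {X : Type} (tau : X -> R) : set (X * R) :=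
  [set p | 0 <= p.2 <= tau p.1].

(* the identification (x, tau x) ~ (T x, 0), as the kernel of [canon] *)
Definition canon {R : realType} {X : Type} (T : X -> X) (tau : X -> R)
  (p : X * R) : X * R := if p.2 == tau p.1 then (T p.1, 0) else p.

Definition susp_rel {R : realType} {X : pmetricType R} (T : X -> X)
  (tau : X -> R) : rel (set_type (Ydom tau)) :=
  fun p q => canon T tau (val p) == canon T tau (val q).

Lemma susp_rel_refl {R : realType} {X : pmetricType R} T tau :
  reflexive (@susp_rel R X T tau).
Proof. by move=> p; rewrite /susp_rel eqxx. Qed.

Lemma susp_rel_sym {R : realType} {X : pmetricType R} T tau :
  symmetric (@susp_rel R X T tau).
Proof. by move=> p q; rewrite /susp_rel eq_sym. Qed.

Lemma susp_rel_trans {R : realType} {X : pmetricType R} T tau :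
  transitive (@susp_rel R X T tau).
Proof. by move=> p q r; rewrite /susp_rel => /eqP -> /eqP ->. Qed.

Canonical susp_equiv {R : realType} {X : pmetricType R} T tau :=
  EquivRel (@susp_rel R X T tau) (susp_rel_refl T tau)
    (susp_rel_sym T tau) (susp_rel_trans T tau).

Definition Xtau {R : realType} {X : pmetricType R} (T : X -> X)
  (tau : X -> R) (htau : forall x, 0 < tau x) : Type :=
  quotient_topology {eq_quot (susp_equiv T tau)}.

Lemma point_in_Ydom {R : realType} {X : pmetricType R} (tau : X -> R)
  (htau : forall x, 0 < tau x) : ((point : X), (0 : R)) \in Ydom tau.
Proof. by apply/mem_set; rewrite /Ydom /= lexx ltW. Qed.

Section XtauInstances.
Context {R : realType} {X : pmetricType R} (T : X -> X) (tau : X -> R)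
  (htau : forall x, 0 < tau x).
HB.instance Definition _ := Topological.copy (Xtau T tau htau)
  (quotient_topology {eq_quot (susp_equiv T tau)}).
HB.instance Definition _ := Quotient.copy (Xtau T tau htau)
  (quotient_topology {eq_quot (susp_equiv T tau)}).
HB.instance Definition _ := isPointed.Build (Xtau T tau htau)
  (\pi_(Xtau T tau htau) (exist _ ((point : X), (0 : R)) (point_in_Ydom tau htau))).
End XtauInstances.

(* The suspension flow theta_t on representatives (x,s), 0 <= s <= tau x:
   (x, s + t) ~ (T^n x, s + t - S_n x) where S_n x <= s + t < S_(n+1) x. *)
Definition flow_rep {R : realType} {X : pmetricType R} (T : X -> X)
  (tau : X -> R) (t : R) (p : X * R) : X * R :=
  let n := [get n : nat | birk T tau n p.1 <= p.2 + t < birk T tau n.+1 p.1] in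
  (iter n T p.1, p.2 + t - birk T tau n p.1).

Definition theta {R : realType} {X : pmetricType R} (T : X -> X)
  (tau : X -> R) (htau : forall x, 0 < tau x) (t : R) (z : Xtau T tau htau) :
  Xtau T tau htau :=
  \pi_(Xtau T tau htau) (insubd (repr z) (flow_rep T tau t (val (repr z)))).

Definition borel_Xtau {R : realType} {X : pmetricType R} (T : X -> X)
  (tau : X -> R) (htau : forall x, 0 < tau x) :=
  g_sigma_algebraType (@open (Xtau T tau htau)).

Definition M_Theta {R : realType} {X : pmetricType R} (T : X -> X)
  (tau : X -> R) (htau : forall x, 0 < tau x) :
  set (probability (borel_Xtau T tau htau) R) :=
  [set nu | forall t : R, 0 <= t -> forall A : set (borel_Xtau T tau htau),
      measurable A -> nu (theta T tau htau t @^-1` A) = nu A].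

(* Time average (1/t) int_0^t f (theta_u z) du  ( = int f d delta_{z,t} ) *)
Definition tavg {R : realType} {X : pmetricType R} (T : X -> X)
  (tau : X -> R) (htau : forall x, 0 < tau x) (f : Xtau T tau htau -> R)
  (z : Xtau T tau htau) (t : R) : R :=
  t^-1 * Rintegral lebesgue_measure `[0, t] (fun u => f (theta T tau htau u z)).

Definition Xhat {R : realType} {X : pmetricType R} (T : X -> X)
  (tau : X -> R) (htau : forall x, 0 < tau x) (Phi : Xtau T tau htau -> R) :
  set (Xtau T tau htau) :=
  [set z | ~ exists l : R, tavg T tau htau Phi z t @[t --> +oo] --> l].

(* V(z): weak* limit points of delta_{z,t} as t -> oo, i.e. Borel probability
   measures nu such that delta_{z,t_n} -> nu weak* for some t_n -> oo *)
Definition Vlim {R : realType} {X : pmetricType R} (T : X -> X)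
  (tau : X -> R) (htau : forall x, 0 < tau x) (z : Xtau T tau htau) :
  set (probability (borel_Xtau T tau htau) R) :=
  [set nu | exists tn : nat -> R, tn @ \oo --> +oo /\
     forall f : Xtau T tau htau -> R, continuous f ->
       (fun n => (tavg T tau htau f z (tn n))%:E) @ \oo -->
         (\int[nu]_(y in [set: borel_Xtau T tau htau]) (f y)%:E)%E].

(* Main.v *)
(** Weak* limits of time averages are invariant, so [M_Theta] gives the largest
    supremum.  Conversely, if [nu] is invariant and [\int f dnu > c], integrating
    Riemann sums of [f] along the flow produces arbitrarily long orbit segments
    along which [f] has average at least [c].  On the base this says that the
    Birkhoff sums of [h - c tau] are almost nonnegative for some points, where
    [h x] is the integral of [f] over the fibre of [x].  Specification at a
    single scale and compactness glue such segments for [- Phi], [Phi] and [H],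
    with geometrically growing lengths, into one orbit whose [Phi]-averages
    oscillate and whose [H]-averages come close to [\int H dnu] again and again.
    Finally, a limsup of time averages is the integral against a measure of
    [Vlim]: an ultrafilter limit of the averages is a positive functional, which
    Riesz's theorem turns into a measure, and a countable dense family of
    continuous functions replaces the ultrafilter by a sequence of times. *)
Require Import Defs.
From HB Require Import structures.
From mathcomp Require Import all_boot all_order all_algebra generic_quotient.
From mathcomp Require Import all_classical all_reals all_analysis.
From mathcomp Require Import measurable_realfun ring lra.
Import Order.TTheory GRing.Theory Num.Theory numFieldTopology.Exports.
Import numFieldNormedType.Exports.
Local Open Scope classical_set_scope.
Local Open Scope ring_scope.
Local Open Scope quotient_scope.

(** * Integration of continuous functions on a compact space *)

(** [Xtau] carries only the quotient topology, so no distance is at hand. The Riesz construction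
    uses that every open set is a cozero set, and the sequence of times uses a countable dense
    family of continuous functions. Both are drawn from a continuous separating distance,
    [susp_dist], which by compactness induces the topology.

    Lower bounds on averages take the homogeneous form: the Birkhoff sum of [h - c tau] over [n]
    steps is at least [- w n]. Such a bound involves no division by the varying return times, it
    adds up under concatenation, and upper bounds for [Phi] are lower bounds for [- Phi], so three
    requirements become one. Specification prescribes the lengths of the segments, whereas an
    invariant measure only yields some long segment; [birk_all_lengths] bridges this by cutting into
    blocks.

    One scale suffices because every bound may lose a fixed amount: the oscillation of [Phi] needs
    just a positive gap, and [H] is tested against each value strictly below an integral, a loss
    that vanishes once suprema are taken. *)

Section CompactBorel.
Context {R : realType} {K : ptopologicalType}.
Local Notation B := (g_sigma_algebraType (@open K)).

Lemma continuous_measurable_borel (f : K -> R) :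
  continuous f -> measurable_fun [set: B] f.
Proof.
move=> /continuousP cf; apply: (measurability _ (RGenOpens.measurableE R)).
move=> _ [_ [a [b ->] <-]]; rewrite setTI; apply: sub_sigma_algebra.
exact/cf/interval_open.
Qed.

Hypothesis cK : compact [set: K].

Lemma continuous_compact_ubound (f : K -> R) : continuous f ->
  exists2 M : R, 0 < M & forall x, `|f x| <= M.
Proof.
move=> cf; have [||c _ H] := @compact_EVT_max K R (fun x => `|f x|) setT _ cK.
- by exists point.
- by apply: continuous_subspaceT => x; apply: cvg_norm; exact: cf.
- exists (`|f c| + 1); first by rewrite ltr_wpDl.
  by move=> x; rewrite (le_trans (H x (in_setT _)))// lerDl.
Qed.

Variable mu : probability B R.

Lemma continuous_integrable (f : K -> R) :
  continuous f -> mu.-integrable [set: B] (EFin \o f).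
Proof.
move=> cf; apply: measurable_bounded_integrable => //.
- by rewrite /= probability_setT ltry.
- exact: continuous_measurable_borel.
- have [M M0 HM] := continuous_compact_ubound f cf.
  by exists M; split; [exact: num_real|move=> x Mx y _; exact: le_trans (HM y) (ltW Mx)].
Qed.

Definition bint (f : K -> R) : R := Rintegral mu [set: B] f.

Lemma bintE (f : K -> R) : continuous f ->
  (\int[mu]_(y in [set: B]) (f y)%:E)%E = (bint f)%:E.
Proof.
by move=> cf; rewrite /bint /Rintegral fineK//; apply: integrable_fin_num => //;
  exact: continuous_integrable.
Qed.

Lemma bint_le (f g : K -> R) : continuous f -> continuous g ->
  (forall x, f x <= g x) -> bint f <= bint g.
Proof.
by move=> cf cg fg; apply: le_Rintegral => //; exact: continuous_integrable.
Qed.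

Lemma bint_cst (c : R) : bint (fun=> c) = c.
Proof. by rewrite /bint Rintegral_cst//= probability_setT/= mulr1. Qed.

Lemma bintD (f g : K -> R) : continuous f -> continuous g ->
  bint (fun x => f x + g x) = bint f + bint g.
Proof. by move=> cf cg; apply: RintegralD => //; exact: continuous_integrable. Qed.

Lemma bintZ (c : R) (f : K -> R) : continuous f ->
  bint (fun x => c * f x) = c * bint f.
Proof. by move=> cf; apply: RintegralZl => //; exact: continuous_integrable. Qed.

End CompactBorel.

Section ContinuousMinMax.
Context {R : realType} {K : topologicalType}.
Implicit Types f g : K -> R.

Lemma continuous_cst (c : R) : continuous (fun _ : K => c).
Proof. by move=> x; exact: cvg_cst. Qed.

Lemma continuous_minr f g : continuous f -> continuous g ->
  continuous (fun x => Num.min (f x) (g x)).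
Proof. by move=> cf cg x; exact: continuous_min (cf x) (cg x). Qed.

Lemma continuous_maxr f g : continuous f -> continuous g ->
  continuous (fun x => Num.max (f x) (g x)).
Proof. by move=> cf cg x; exact: continuous_max (cf x) (cg x). Qed.

End ContinuousMinMax.
Arguments continuous_cst {R K} c.

(** * Measures of open sets as limits of integrals of continuous functions *)

Section CozeroMeasure.
Context {R : realType} {K : ptopologicalType}.
Local Notation B := (g_sigma_algebraType (@open K)).
Hypothesis cK : compact [set: K].

Definition cozero_spec (U : set K) (g : K -> R) :=
  [/\ continuous g, forall x, 0 <= g x & U = [set x | 0 < g x]].

(** For [g >= 0] these functions increase with [n] to the indicator of the set where [g] is
    positive. *)
Definition cozero_approx (g : K -> R) (n : nat) (x : K) : R :=
  Num.min 1 (n%:R * g x).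

Lemma cozero_approx_continuous g n : continuous g -> continuous (cozero_approx g n).
Proof.
move=> cg; apply: continuous_minr => x; first exact: cvg_cst.
by apply: cvgMr; exact: cg.
Qed.

Lemma cozero_approx_homo g x : 0 <= g x ->
  {homo cozero_approx g ^~ x : n m / (n <= m)%N >-> n <= m}.
Proof.
move=> g0 n m nm; rewrite /cozero_approx le_min ge_min lexx/=.
by rewrite ge_min ler_wpM2r ?orbT// ler_nat.
Qed.

Lemma cozero_approx_eq1 g x : 0 < g x ->
  \forall n \near \oo, cozero_approx g n x = 1.
Proof.
move=> gx; near=> n; rewrite /cozero_approx; apply/min_idPl.
rewrite -ler_pdivrMr// mul1r.
by near: n; exact: nbhs_infty_ger.
Unshelve. all: by end_near. Qed.

(** Monotone convergence. Integrals of continuous functions thus determine the measure of an open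
    set. *)
Lemma bint_cozero_cvg (mu : probability B R) (U : set K) g :
  cozero_spec U g -> (bint mu (cozero_approx g n))%:E @[n --> \oo] --> mu U.
Proof.
move=> [cg g0 UE].
have oU : open U.
  have -> : U = g @^-1` [set y | 0 < y].
    by rewrite UE.
  by move/continuousP: cg; apply; exact: open_gt.
have mU : measurable (U : set B) by exact: sub_sigma_algebra.
have <- : (\int[mu]_(x in [set: B])
    (fun x => limn (fun n => (cozero_approx g n x)%:E)) x = mu U)%E.
  transitivity (\int[mu]_(x in [set: B]) (\1_U x)%:E)%E.
    apply: eq_integral => x _; apply/cvg_lim => //.
    have [Ux|nUx] := pselect (U x).
      rewrite indicE mem_set//; apply: cvg_near_cst.
      have : 0 < g x by move: Ux; rewrite UE.
      by move=> /cozero_approx_eq1; apply: filterS => n ->.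
    rewrite indicE memNset//; apply: cvg_near_cst; apply: nearW => n.
    have gx0 : g x = 0.
      apply/eqP; rewrite eq_le g0 andbT leNgt; apply/negP => gx.
      by apply: nUx; rewrite UE.
    rewrite /cozero_approx gx0 mulr0; congr EFin; exact/min_idPr.
  by rewrite integral_indic// setIT.
have -> : (fun n => (bint mu (cozero_approx g n))%:E) =
    (fun n => \int[mu]_(x in [set: B]) (cozero_approx g n x)%:E)%E.
  by apply/funext => n; rewrite bintE//; exact: cozero_approx_continuous.
apply: cvg_monotone_convergence => //.
- move=> n; apply/measurable_EFinP; apply: continuous_measurable_borel.
  exact: cozero_approx_continuous.
- by move=> n x _; rewrite lee_fin le_min ler01 mulr_ge0.
- by move=> x _ n m nm; rewrite lee_fin; exact: cozero_approx_homo.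
Qed.

Hypothesis perfK : forall U : set K, open U -> exists g, cozero_spec U g.

(** The image of [mu] under [h] agrees with [mu] on open sets, because [cozero_approx (g \o h) n] is
    [cozero_approx g n \o h], so that the two limits are limits of the same sequence. Open sets are
    stable under intersection and generate the Borel sets, hence the measures coincide. *)
Lemma bint_invariant_measure (mu : probability B R) (h : K -> K) :
  continuous h ->
  (forall f, continuous f -> bint mu (f \o h) = bint mu f) ->
  forall A : set B, measurable A -> mu (h @^-1` A) = mu A.
Proof.
move=> ch hh.
have mh : measurable_fun [set: B] (h : B -> B).
  apply: (@measurability _ _ B B _ _ (@open K) erefl) => _ [A oA <-]; rewrite setTI.
  by apply: sub_sigma_algebra; move/continuousP: ch; apply.
pose nu := measure_function_pushforward__canonical__measure_function_Measure mu mh.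
move=> A mA; rewrite -[LHS]/(nu A).
refine (@measure_unique _ R B (@open K) (fun=> setT) erefl _ _ _ nu mu _ _ A mA) => //.
- by move=> ? ? ? ?; exact: openI.
- by move=> _; exact: openT.
- by rewrite bigcup_const//; exists 0%N.
- move=> U oU; rewrite -[nu U]/(mu (h @^-1` U)).
  have [g [cg g0 UE]] := perfK _ oU.
  have H1 := bint_cozero_cvg mu U g (And3 cg g0 UE).
  have H2 : (bint mu (cozero_approx (g \o h) n))%:E @[n --> \oo] --> mu (h @^-1` U).
    apply: bint_cozero_cvg; split => //.
    - by move=> x; apply: continuous_comp; [exact: ch|exact: cg].
    - by move=> x; exact: g0.
    - by rewrite UE.
  apply: cvg_unique H2 _ => //; apply: cvg_trans H1.
  rewrite (_ : (fun n => _) = (fun n => (bint mu (cozero_approx g n))%:E)) //.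
  apply/funext => n; rewrite -(hh (cozero_approx g n))//.
  exact: cozero_approx_continuous.
- move=> _; rewrite -[nu _]/(mu (h @^-1` setT)) preimage_setT.
  by rewrite probability_setT ltry.
Qed.

End CozeroMeasure.

(** * Riesz representation *)

Section MeanFunctional.
Context {R : realType} {K : ptopologicalType}.
Implicit Types f g : K -> R.

(** A positive normalised linear functional on the continuous functions. [L] is total but
    constrained only at continuous arguments, which is where limits of time averages are known to
    exist. *)
Definition mean_functional (L : (K -> R) -> R) :=
  [/\ forall (a : R) f g, continuous f -> continuous g ->
        L (fun x => a * f x + g x) = a * L f + L g,
      forall f g, continuous f -> continuous g ->
        (forall x, f x <= g x) -> L f <= L g &
      L (fun=> 1) = 1].

Variable L : (K -> R) -> R.
Hypothesis mL : mean_functional L.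

Lemma mean_le f g : continuous f -> continuous g ->
  (forall x, f x <= g x) -> L f <= L g.
Proof. by case: mL => _ + _; apply. Qed.

Let L_lin (a : R) f g : continuous f -> continuous g ->
  L (fun x => a * f x + g x) = a * L f + L g.
Proof. by case: mL => + _ _; apply. Qed.

Lemma mean_cst (c : R) : L (fun=> c) = c.
Proof.
have ccst := @continuous_cst R K; have [_ _ L1] := mL.
have L0 : L (fun=> 0) = 0.
  have := L_lin 1 (fun=> 0) (fun=> 0) (ccst 0) (ccst 0).
  have -> : (fun _ : K => 1 * 0 + 0) = (fun=> 0 : R).
    by apply/funext => x; rewrite mulr0 addr0.
  by move=> /esym/eqP; rewrite mul1r -subr_eq0 addrK => /eqP.
have := L_lin c (fun=> 1) (fun=> 0) (ccst 1) (ccst 0).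
have -> : (fun _ : K => c * 1 + 0) = (fun=> c).
  by apply/funext => x; rewrite mulr1 addr0.
by rewrite L1 L0 mulr1 addr0.
Qed.

Lemma mean_add f g : continuous f -> continuous g ->
  L (fun x => f x + g x) = L f + L g.
Proof.
move=> cf cg; have := L_lin 1 f g cf cg; rewrite mul1r => <-.
by congr L; apply/funext => x; rewrite mul1r.
Qed.

Lemma mean_scale (a : R) f : continuous f -> L (fun x => a * f x) = a * L f.
Proof.
move=> cf; have := L_lin a f (fun=> 0) cf (continuous_cst 0); rewrite mean_cst addr0 => <-.
by congr L; apply/funext => x; rewrite addr0.
Qed.

Lemma mean_sum (F : nat -> K -> R) n : (forall i, continuous (F i)) ->
  continuous (fun x => \sum_(0 <= i < n) F i x) /\
  L (fun x => \sum_(0 <= i < n) F i x) = \sum_(0 <= i < n) L (F i).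
Proof.
move=> cF; elim: n => [|n [IHc IHL]].
  have -> : (fun x => \sum_(0 <= i < 0) F i x) = (fun=> 0 : R).
    by apply/funext => x; rewrite big_nil.
  by rewrite big_nil mean_cst; split => //; exact: continuous_cst.
have -> : (fun x => \sum_(0 <= i < n.+1) F i x) =
    (fun x => (\sum_(0 <= i < n) F i x) + F n x).
  by apply/funext => x; rewrite big_nat_recr.
split; first by move=> x; exact: cvgD (IHc x) (cF n x).
by rewrite mean_add// IHL big_nat_recr.
Qed.

End MeanFunctional.

Section Riesz.
Context {R : realType} {K : ptopologicalType}.
Local Notation B := (g_sigma_algebraType (@open K)).
Implicit Types f g : K -> R.
Hypothesis cK : compact [set: K].
Hypothesis perfK : forall U : set K, open U -> exists g : K -> R, cozero_spec U g.

Lemma bint_mean (mu : probability B R) : mean_functional (bint mu).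
Proof.
split; [move=> a f g cf cg|exact: bint_le|exact: bint_cst].
rewrite bintD//; first by rewrite bintZ.
by move=> x; apply: cvgMr; exact: cf.
Qed.

Variable L : (K -> R) -> R.
Hypothesis mL : mean_functional L.
Let L_cst := mean_cst L mL.
Let L_le := mean_le L mL.

(** Vanishing off [U] is asked instead of having support inside [U]; subtracting a small constant
    and truncating at 0 later does the work of a support condition. *)
Definition subordinate (U : set K) (f : K -> R) :=
  [/\ continuous f, forall x, 0 <= f x <= 1 & forall x, ~ U x -> f x = 0].

Definition open_content (U : set K) : \bar R :=
  ereal_sup [set (L f)%:E | f in subordinate U].

Definition riesz_outer (A : set K) : \bar R :=
  ereal_inf [set open_content U | U in [set U | open U /\ A `<=` U]].

Let subordinate0 U : subordinate U (fun=> 0).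
Proof. by split => [|x|//]; [exact: continuous_cst|rewrite lexx ler01]. Qed.

Let open_content_ge0 U : (0 <= open_content U)%E.
Proof. by apply: ereal_sup_ubound; exists (fun=> 0); rewrite ?L_cst. Qed.

Let open_content_le1 U : (open_content U <= 1)%E.
Proof.
apply: ge_ereal_sup => _ [f [cf f01 _] <-]; rewrite lee_fin -[leRHS]L_cst.
by apply: L_le => [//||x]; [exact: continuous_cst|have /andP[] := f01 x].
Qed.

Let le_open_content U V : U `<=` V -> (open_content U <= open_content V)%E.
Proof.
move=> UV; apply: ereal_sup_le => _ [f [cf f01 fU] <-]; exists f => //.
by split => // x Vx; apply: fU => /UV.
Qed.

Let open_content_fin U : open_content U \is a fin_num.
Proof.
rewrite ge0_fin_numE ?open_content_ge0//.
by rewrite (le_lt_trans (open_content_le1 U))// ltry.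
Qed.

Lemma riesz_outer_open U : open U -> riesz_outer U = open_content U.
Proof.
move=> oU; apply/eqP; rewrite eq_le; apply/andP; split.
  by apply: ereal_inf_lbound; exists U => //; split.
by apply: le_ereal_inf_tmp => _ [V [oV UV] <-]; exact: le_open_content.
Qed.

Let riesz_outer_ge0 A : (0 <= riesz_outer A)%E.
Proof. by apply: le_ereal_inf_tmp => _ [V _ <-]; exact: open_content_ge0. Qed.

Let riesz_outer_le1 A : (riesz_outer A <= 1)%E.
Proof.
apply: (le_trans _ (open_content_le1 setT)); apply: ereal_inf_lbound.
by exists setT => //; split; [exact: openT|].
Qed.

Let riesz_outer_fin A : riesz_outer A \is a fin_num.
Proof.
rewrite ge0_fin_numE ?riesz_outer_ge0//.
by rewrite (le_lt_trans (riesz_outer_le1 A))// ltry.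
Qed.

Let le_riesz_outer : {homo riesz_outer : A B / A `<=` B >-> (A <= B)%E}.
Proof.
move=> A B AB; apply: le_ereal_inf_tmp => _ [V [oV BV] <-].
by apply: ereal_inf_lbound; exists V => //; split => //; exact: subset_trans BV.
Qed.

Let riesz_outer0 : riesz_outer set0 = 0%E.
Proof.
rewrite (riesz_outer_open _ open0); apply/eqP.
rewrite eq_le open_content_ge0 andbT.
apply: ge_ereal_sup => _ [f [cf f01 f0] <-].
rewrite (_ : f = fun=> 0) ?L_cst//.
by apply/funext => x; exact: f0.
Qed.

(* Dini: the partial sums of [cozero_approx] increase to a function above [f]. *)
Let open_content_sigma_subadditive (U : (set K)^nat) : (forall n, open (U n)) ->
  (open_content (\bigcup_n U n) <= \sum_(i <oo) open_content (U i))%E.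
Proof.
move=> oU; have /choice[g Hg] := fun n => perfK (U n) (oU n).
have cg n : continuous (g n) by have [] := Hg n.
have g0 n x : 0 <= g n x by have [] := Hg n.
have UE n : U n = [set x | 0 < g n x] by have [] := Hg n.
apply: ge_ereal_sup => _ [f [cf f01 fU] <-].
apply/lee_addgt0Pr => e e0.
(* The same [n] counts the terms and sharpens each of them, so that a single index goes to infinity
   and the near-covering form of compactness applies. *)
have : \forall n \near \oo, [set: K] `<=`
    (fun x => f x <= \sum_(0 <= i < n) cozero_approx (g i) n x + e).
  move/compact_near_coveringP : cK; apply => x _.
  have ca0 i n y : 0 <= cozero_approx (g i) n y.
    by rewrite le_min ler01 mulr_ge0.
  have [[i _ Ui]|nU] := pselect ((\bigcup_n U n) x); last first.
    near=> y n => /=.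
    rewrite (@le_trans _ _ e)//; last by rewrite lerDr sumr_ge0.
    rewrite ltW//; near: y.
    have : nbhs (f x) [set z | z < e] by apply: open_nbhs_nbhs; split;
      [exact: open_lt|rewrite /= fU].
    exact: cf.
  have gi : 0 < g i x by move: Ui; rewrite UE.
  have gnear : \forall y \near x, g i x / 2 < g i y.
    have : nbhs (g i x) [set z | g i x / 2 < z] by apply: open_nbhs_nbhs; split;
      [exact: open_gt|rewrite /= gtr_pMr// invf_lt1// ltr1n].
    exact: cg.
  near=> y n => /=.
  have hy : g i x / 2 < g i y by near: y.
  rewrite (@le_trans _ _ 1)//; first by have /andP[] := f01 y.
  rewrite (@le_trans _ _ (\sum_(0 <= i < n) cozero_approx (g i) n y))//; last first.
    by rewrite lerDl ltW.
  have ni : (i < n)%N by near: n; exact: nbhs_infty_gt.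
  rewrite (bigD1_seq i) ?iota_uniq//= ?mem_index_iota//.
  rewrite -[leLHS]addr0 lerD ?sumr_ge0//.
  rewrite /cozero_approx le_min lexx/=.
  rewrite (@le_trans _ _ (n%:R * (g i x / 2)))//; last by rewrite ler_wpM2l// ltW.
  rewrite -ler_pdivrMr ?divr_gt0//.
  by near: n; exact: nbhs_infty_ger.
move=> [N _ /(_ N (leqnn N)) HN].
have cca i : continuous (cozero_approx (g i) N) by exact: cozero_approx_continuous.
have [cS LS] := mean_sum L mL (fun i => cozero_approx (g i) N) N cca.
have H : L f <= \sum_(0 <= i < N) L (cozero_approx (g i) N) + e.
  rewrite -LS -[e in leRHS](L_cst e) -(mean_add _ mL)//;
    last exact: continuous_cst.
  apply: L_le => //.
  - by move=> x; exact: cvgD (cS x) (continuous_cst e x).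
  - by move=> x; exact: HN.
rewrite (@le_trans _ _ (\sum_(0 <= i < N) L (cozero_approx (g i) N) + e)%:E)//.
rewrite EFinD leeD2r// -sumEFin.
apply: (le_trans _ (nneseries_lim_ge N _)) => //.
apply: lee_sum => i _; apply: ereal_sup_ubound.
exists (cozero_approx (g i) N) => //; split => // x.
  by rewrite le_min ler01 mulr_ge0//= ge_min lexx.
rewrite UE /= => /negP; rewrite -leNgt => gx.
have gx0 : g i x = 0 by apply/eqP; rewrite eq_le gx g0.
by rewrite /cozero_approx gx0 mulr0; exact/min_idPr.
Unshelve. all: by end_near. Qed.

Let riesz_outer_sigma_subadditive : sigma_subadditive riesz_outer.
Proof.
move=> A; apply/lee_addgt0Pr => e e0.
apply: (le_trans _ (epsilon_trick _ _ _)); [|by []|exact: ltW].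
have /choice[U HU] : forall n, exists V, [/\ open V, A n `<=` V &
    (open_content V <= riesz_outer (A n) + (e / (2 ^ n.+1)%:R)%:E)%E].
  move=> n.
  have en : 0 < e / (2 ^ n.+1)%:R by rewrite divr_gt0// ltr0n expn_gt0.
  have [_ [V [oV AV] <-] HV] := lb_ereal_inf_adherent en (riesz_outer_fin (A n)).
  by exists V; split => //; exact: ltW.
apply: (@le_trans _ _ (open_content (\bigcup_n U n))).
  apply: ereal_inf_lbound; exists (\bigcup_n U n) => //; split.
    by apply: bigcup_open => n _; have [] := HU n.
  by apply: subset_bigcup => n _; have [] := HU n.
apply: (le_trans (open_content_sigma_subadditive _ _)).
  by move=> n; have [] := HU n.
by apply: lee_nneseries => // n _; have [] := HU n.
Qed.

HB.instance Definition _ := isOuterMeasure.Build R K riesz_outer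
  riesz_outer0 riesz_outer_ge0 le_riesz_outer riesz_outer_sigma_subadditive.


(** Let [f] be subordinate to [V] meet [U]. The open set [W] of points of [V] where [f < e] contains
    [V] minus [U]. A function [g] subordinate to [W] vanishes wherever the truncation [fe] of
    [f - e] is positive, so [fe + g] is still subordinate to [V]; this costs only [e]. *)
Let open_caratheodory U : open U -> riesz_outer.-caratheodory U.
Proof.
move=> oU; apply: le_caratheodory_measurable => A.
apply: le_ereal_inf_tmp => _ [V [oV AV] <-].
apply: (@le_trans _ _ (riesz_outer (V `&` U) + riesz_outer (V `&` ~` U))%E).
  by apply: leeD; apply: le_riesz_outer; exact: setSI.
rewrite riesz_outer_open; last exact: openI.
rewrite -(fineK (riesz_outer_fin (V `&` ~` U))) -(fineK (open_content_fin V)).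
set a := fine _; set v := fine _.
rewrite -leeBrDr//; apply: ge_ereal_sup => _ [f [cf f01 fVU] <-].
apply/lee_addgt0Pr => e e0; rewrite -EFinB -EFinD lee_fin.
pose W := V `&` [set x | f x < e].
have oW : open W.
  apply: openI => //; move/continuousP : cf => /(_ [set y | y < e]); apply.
  exact: open_lt.
suff : (a%:E <= (v + e - L f)%:E)%E by rewrite lee_fin; lra.
rewrite /a fineK//; apply: (@le_trans _ _ (open_content W)).
  rewrite -riesz_outer_open//; apply: le_riesz_outer => x [Vx nUx].
  by split => //=; rewrite fVU// => -[].
apply: ge_ereal_sup => _ [g [cg g01 gW] <-]; rewrite lee_fin.
pose fe x := Num.max 0 (f x - e).
have cfe : continuous fe.
  apply: continuous_maxr; first exact: continuous_cst.
  by move=> x; apply: cvgB; [exact: cf|exact: cvg_cst].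
have ch : continuous (fun x => fe x + g x).
  by move=> x; exact: cvgD (cfe x) (cg x).
have : ((L (fun x => fe x + g x))%:E <= v%:E)%E.
  rewrite /v fineK//; apply: ereal_sup_ubound; exists (fun x => fe x + g x) => //.
  split => // x.
    have /andP[f0 f1] := f01 x; have /andP[g0 g1] := g01 x.
    have [fxe|fxe] := ltP (f x) e.
      by rewrite /fe (max_idPl _) ?add0r ?g0// subr_le0 ltW.
    rewrite gW ?addr0; last by move=> [_ /=]; rewrite ltNge fxe.
    by rewrite /fe le_max lexx/= ge_max ler01/= lerBlDr (le_trans f1)// lerDl ltW.
  move=> nVx; rewrite gW ?addr0; last by move=> [].
  by rewrite /fe fVU ?sub0r ?(max_idPl _)// ?oppr_le0 ?ltW// => -[].
rewrite lee_fin (mean_add _ mL)// => H.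
suff : L f <= L fe + e by lra.
rewrite -[e in leRHS](L_cst e) -(mean_add _ mL)//; last exact: continuous_cst.
apply: L_le => //; first by move=> x; exact: cvgD (cfe x) (continuous_cst e x).
by move=> x; rewrite -lerBlDr /fe le_max lexx orbT.
Qed.

Definition riesz_measure : set B -> \bar R := riesz_outer.

Let borel_caratheodory (A : set B) : measurable A -> riesz_outer.-caratheodory A.
Proof.
apply: smallest_sub; last exact: open_caratheodory.
exact: (sigma_algebra_measurable (caratheodory_type riesz_outer)).
Qed.

Let riesz_measure_sigma_additive : semi_sigma_additive riesz_measure.
Proof.
move=> F mF tF mUF; apply: caratheodory_measure_sigma_additive => //.
- by move=> i; exact: borel_caratheodory.
- exact: borel_caratheodory.
Qed.

HB.instance Definition _ := isMeasure.Build _ B R riesz_measure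
  riesz_outer0 riesz_outer_ge0 riesz_measure_sigma_additive.

Let riesz_measure_setT : riesz_measure setT = 1%E.
Proof.
rewrite /riesz_measure riesz_outer_open; last exact: openT.
apply/eqP; rewrite eq_le open_content_le1/=.
apply: ereal_sup_ubound; exists (fun=> 1); last by rewrite L_cst.
by split => [|x|x /(_ I)//]; [exact: continuous_cst|rewrite ler01 lexx].
Qed.

HB.instance Definition _ := Measure_isProbability.Build _ B R riesz_measure
  riesz_measure_setT.

Let mu : probability B R := riesz_measure.

(** The horizontal slice of [n f] between the heights [k] and [k + 1]; the slices below [n] add up
    to [n f] when [0 <= f <= 1]. *)
Definition layer f (n k : nat) (x : K) : R :=
  Num.min 1 (Num.max 0 (n%:R * f x - k%:R)).

Let layer_continuous f n k : continuous f -> continuous (layer f n k).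
Proof.
move=> cf; apply: continuous_minr; first exact: continuous_cst.
apply: continuous_maxr; first exact: continuous_cst.
by move=> x; apply: cvgB; [apply: cvgMr; exact: cf|exact: cvg_cst].
Qed.

Let layer01 f n k x : 0 <= layer f n k x <= 1.
Proof. by rewrite /layer le_min ler01 le_max lexx/= ge_min lexx. Qed.

Let layer_sum f n x : 0 <= f x <= 1 ->
  \sum_(0 <= k < n) layer f n k x = n%:R * f x.
Proof.
move=> /andP[f0 f1].
suff H m : \sum_(0 <= k < m) layer f n k x = Num.min m%:R (n%:R * f x).
  by rewrite H; apply/min_idPr; rewrite ler_piMr.
have nf0 : 0 <= n%:R * f x by rewrite mulr_ge0.
rewrite /layer; elim: m => [|m IH]; first by rewrite big_nil; apply/esym/min_idPl.
rewrite big_nat_recr//= IH -[m.+1]addn1 natrD.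
have m0 : 0 <= m%:R :> R by [].
move: nf0 m0; set y := n%:R * f x; rewrite /Num.min /Num.max => nf0 m0.
by case: (ltP 0 (y - m%:R)) => ?; repeat case: ltP => ?; lra.
Qed.

Let layer_le_measure f n k : continuous f ->
  ((L (layer f n k))%:E <= mu [set x | (k%:R < n%:R * f x)%R])%E.
Proof.
move=> cf; rewrite [mu _]riesz_outer_open; last first.
  have cnf : continuous (fun x => n%:R * f x) by move=> x; apply: cvgMr; exact: cf.
  by move/continuousP : cnf => /(_ [set y | k%:R < y]); apply; exact: open_gt.
apply: ereal_sup_ubound; exists (layer f n k) => //.
split => //; first exact: layer_continuous.
move=> x /= /negP; rewrite -leNgt => H.
by rewrite /layer (max_idPl _) ?subr_le0//; exact/min_idPr.
Qed.

Let measure_le_layer f n k : continuous f ->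
  (mu [set x | (k.+1%:R < n%:R * f x)%R] <= (bint mu (layer f n k))%:E)%E.
Proof.
move=> cf; set U := (X in mu X).
have mU : measurable (U : set B).
  apply: sub_sigma_algebra.
  have cnf : continuous (fun x => n%:R * f x) by move=> x; apply: cvgMr; exact: cf.
  by move/continuousP : cnf => /(_ [set y | k.+1%:R < y]); apply; exact: open_gt.
rewrite -bintE//; last exact: layer_continuous.
rewrite -[U in mu U]setIT -integral_indic//.
apply: ge0_le_integral.
- exact: measurableT.
- by move=> x xT; rewrite lee_fin.
- by apply/measurable_EFinP; exact: measurable_indic.
- apply/measurable_EFinP; apply: continuous_measurable_borel.
  exact: layer_continuous.
move=> x xT; rewrite lee_fin indicE.
case: (boolP (x \in U)) => [|_]; last by have /andP[] := layer01 f n k x.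
rewrite inE /U /= => H; rewrite /layer le_min lexx/= le_max.
by apply/orP; right; rewrite lerBrDr addrC natr1 ltW.
Qed.

(** Slice [k + 1] under [L] is at most the measure of the set where [n f > k + 1], which is at most
    the integral of slice [k]. Summing with this shift leaves only the bottom slice uncompared; it
    contributes at most 1, which is negligible after division by the number of slices. *)
Let mean_le_bint f : continuous f -> (forall x, 0 <= f x <= 1) ->
  L f <= bint mu f.
Proof.
move=> cf f01; apply/ler_addgt0Pr => e e0.
have [n ne] : exists n, e^-1 < n.+1%:R.
  exists (Num.truncn e^-1); apply: truncnS_gt.
have n0 : 0 < n.+1%:R :> R by rewrite ltr0n.
have clay k : continuous (layer f n.+1 k) by exact: layer_continuous.
have scale M : mean_functional M ->
    n.+1%:R * M f = \sum_(0 <= k < n.+1) M (layer f n.+1 k).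
  move=> mM; rewrite -(mean_scale _ mM)//.
  have [_ <-] := mean_sum _ mM (fun k => layer f n.+1 k) n.+1 clay.
  by congr M; apply/funext => x; rewrite layer_sum.
have : n.+1%:R * L f <= 1 + n.+1%:R * bint mu f.
  rewrite (scale L mL) (scale (bint mu) (bint_mean mu)).
  rewrite big_nat_recl//= [in leRHS]big_nat_recr//=.
  apply: lerD.
    rewrite -[leRHS](L_cst 1); apply: L_le => [//||x]; first exact: continuous_cst.
    by have /andP[] := layer01 f n.+1 0 x.
  rewrite -[leLHS]addr0; apply: lerD.
    apply: ler_sum => k _; rewrite -lee_fin.
    by apply: le_trans (layer_le_measure f n.+1 k.+1 cf) (measure_le_layer f n.+1 k cf).
  rewrite -(mean_cst _ (bint_mean mu) 0).
  apply: bint_le => // x; last by have /andP[] := layer01 f n.+1 n x.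
  exact: continuous_cst.
rewrite -ler_pdivlMl// mulrDr mulKf ?gt_eqF// mulr1 => /le_trans; apply.
by rewrite addrC lerD2l ltW// invf_plt ?posrE.
Qed.

(** The one-sided bound applied to [1 - f] gives the reverse inequality, both functionals being
    linear and normalised. *)
Let bint_mu_eq f : continuous f -> (forall x, 0 <= f x <= 1) ->
  bint mu f = L f.
Proof.
move=> cf f01; apply/eqP; rewrite eq_le mean_le_bint// andbT.
have cg : continuous (fun x => -1 * f x + 1).
  by move=> x; apply: cvgD (cvg_cst _); apply: cvgMr; exact: cf.
have : L (fun x => -1 * f x + 1) <= bint mu (fun x => -1 * f x + 1).
  by apply: mean_le_bint => // x; have := f01 x; lra.
have [ll _ _] := mL; have [lb _ _] := bint_mean mu.
rewrite ll ?lb// ?(mean_cst _ (bint_mean mu)) ?L_cst; try exact: continuous_cst.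
lra.
Qed.

Lemma riesz_representation : exists nu : probability B R,
  forall f, continuous f -> bint nu f = L f.
Proof.
exists mu => f cf; have [M M0 HM] := continuous_compact_ubound cK f cf.
pose g x := (2 * M)^-1 * f x + 2^-1.
have M2 : 0 < 2 * M by rewrite mulr_gt0.
have cg : continuous g.
  by move=> x; apply: cvgD (cvg_cst _); apply: cvgMr; exact: cf.
have g01 x : 0 <= g x <= 1.
  have := HM x; rewrite ler_norml => /andP[H1 H2].
  rewrite /g -[2^-1](@mulKf _ (2 * M)) ?gt_eqF// -mulrDr.
  rewrite mulr_ge0 ?invr_ge0 ?(ltW M2)//=; last by lra.
  by rewrite -ler_pdivlMl ?invr_gt0// invrK mulr1; lra.
have fE : f = fun x => (2 * M) * g x + (- M).
  apply/funext => x; rewrite /g mulrDr mulVKf ?gt_eqF//; lra.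
have [ll _ _] := mL; have [lb _ _] := bint_mean mu.
have cM := continuous_cst (K := K) (- M).
rewrite fE (lb _ g (fun=> - M))// (ll _ g (fun=> - M))//.
by rewrite bint_mu_eq// (mean_cst _ (bint_mean mu)) L_cst.
Qed.

End Riesz.

(** * Compact metrizable spaces *)

Section CompactMetrizable.
Context {R : realType} {K : ptopologicalType}.
Hypothesis cK : compact [set: K].
Variable D : K -> K -> R.
Hypothesis Dxx : forall x, D x x = 0.
Hypothesis Dsym : forall x y, D x y = D y x.
Hypothesis Dtri : forall x y z, D x z <= D x y + D y z.
Hypothesis Dsep : forall x y, D x y = 0 -> x = y.
Hypothesis Dcont : forall x, continuous (D x).

Let D_ge0 x y : 0 <= D x y.
Proof. by have := Dtri x y x; rewrite Dxx (Dsym y x); lra. Qed.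

Let D_nbhs x (e : R) : 0 < e -> \forall y \near x, D x y < e.
Proof.
move=> e0; have : nbhs (D x x) [set z | z < e].
  by apply: open_nbhs_nbhs; split; [exact: open_lt|rewrite /= Dxx].
exact: Dcont.
Qed.

Let lipschitz_continuous (g : K -> R) (c : R) : 0 < c ->
  (forall x y, `|g x - g y| <= c * D x y) -> continuous g.
Proof.
move=> c0 Hg x; apply/cvgrPdist_le => e e0.
have := D_nbhs x (e / c) (divr_gt0 e0 c0); apply: filterS => y Hy.
apply: (le_trans (Hg x y)); rewrite mulrC -ler_pdivlMr//; exact: ltW.
Qed.

(** [D] is only assumed continuous and separating. On the compact complement of an open
    neighbourhood of [x], [D x] attains a positive minimum, which serves as the radius; so the balls
    of [D] generate the topology. *)
Let D_ball_open x (A : set K) : nbhs x A ->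
  exists2 e : R, 0 < e & forall y, D x y < e -> A y.
Proof.
rewrite nbhsE => -[U [oU Ux] UA].
have [UT|/existsNP[c0 nUc0]] := pselect (forall y, U y).
  by exists 1 => // y _; exact: UA.
have cC : compact (~` U).
  by apply: (@subclosed_compact _ (~` U) setT) => //; exact: open_closedC.
have [||c] := @compact_EVT_min K R (D x) (~` U) _ cC.
- by exists c0.
- by apply: continuous_subspaceT; exact: Dcont.
rewrite inE => nUc Hc; exists (D x c).
  rewrite lt_neqAle D_ge0 andbT eq_sym; apply/eqP => /Dsep xc.
  by apply: nUc; rewrite -xc.
move=> y Dy; apply: UA; apply: contrapT => nUy.
by have := Hc y; rewrite inE => /(_ nUy); rewrite leNgt Dy.
Qed.

Lemma metric_cozero (U : set K) : open U -> exists g : K -> R, cozero_spec U g.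
Proof.
move=> oU.
have [UT|/existsNP[c0 nUc0]] := pselect (forall y, U y).
  exists (fun=> 1); split => //; first exact: continuous_cst.
  by apply/seteqP; split => // x _ /=; exact: ltr01.
pose g x := inf [set D x w | w in ~` U].
have has x : has_inf [set D x w | w in ~` U].
  split; first by exists (D x c0); exists c0.
  by exists 0 => _ [w _ <-].
have gle x w : ~ U w -> g x <= D x w.
  by move=> nUw; apply: ge_inf; [have [] := has x|exists w].
have g0 x : 0 <= g x.
  by apply: lb_le_inf; [have [] := has x|move=> _ [w _ <-]].
have gtri x y : g x - g y <= D x y.
  rewrite lerBlDr -lerBlDl; apply: lb_le_inf; first by have [] := has y.
  move=> _ [w nUw <-]; rewrite lerBlDl; apply: le_trans (gle x w nUw) _.
  exact: Dtri.
exists g; split => //.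
  apply: (lipschitz_continuous g 1) => // x y; rewrite mul1r ler_norml gtri.
  by rewrite andbT lerNl opprB Dsym gtri.
apply/seteqP; split => x /=.
  move=> Ux; have [e e0 He] := D_ball_open x U (open_nbhs_nbhs (conj oU Ux)).
  apply: lt_le_trans e0 _; apply: lb_le_inf; first by have [] := has x.
  by move=> _ [w nUw <-]; rewrite leNgt; apply/negP => /He.
by move=> gx; apply: contrapT => /(gle x); rewrite Dxx leNgt gx.
Qed.

Let D_net (e : R) : 0 < e -> exists s : seq K, forall x, exists2 w, w \in s & D x w < e.
Proof.
move=> e0; move: cK; rewrite compact_cover => /(_ K setT (fun w => [set x | D w x < e])).
case.
- move=> w _; have /continuousP/(_ [set y | y < e]) := Dcont w; apply.
  exact: open_lt.
- by move=> x _; exists x => //=; rewrite Dxx.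
move=> S _ HS; exists (finmap.enum_fset S) => x.
by have [w wS Hw] := HS x I; exists w => //; rewrite Dsym.
Qed.

Lemma metric_uniform_continuous (f : K -> R) (e : R) : continuous f -> 0 < e ->
  exists2 d : R, 0 < d & forall x y, D x y < d -> `|f x - f y| < e.
Proof.
move=> cf e0.
have : \forall d \near (0:R)^'+, [set: K] `<=`
    (fun x => forall y, D x y < d -> `|f x - f y| < e).
  move/compact_near_coveringP : cK; apply => x _.
  have : \forall y \near x, `|f x - f y| < e / 2.
    by move: (cf x) => /cvgrPdist_lt; apply; rewrite divr_gt0.
  move=> /D_ball_open[r r0 Hr].
  have r20 : 0 < r / 2 by rewrite divr_gt0.
  have Hx := D_nbhs x _ r20.
  near=> x' d => /= y Hy.
  have Hx' : D x x' < r / 2 by near: x'.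
  have dr : d < r / 2 by near: d; exact: nbhs_right_lt.
  have H1 := Hr x'; have H2 := Hr y; have := Dtri x x' y.
  move=> T1.
  rewrite (_ : f x' - f y = (f x - f y) - (f x - f x')); last by ring.
  apply: (le_lt_trans (ler_normB _ _)); rewrite [e]splitr ltrD//.
    by apply: H2; lra.
  by apply: H1; lra.
move=> H; have [d [Hd d0]] := filter_ex (filterI H (nbhs_right_gt (0:R))).
by exists d => // x y; exact: Hd.
Unshelve. all: by end_near. Qed.

(* McShane-type minima of [q + n D(., w)], with [q] rational and [w] in a finite net. *)
Definition mcshane (s : seq K) (n : nat) (q0 : rat) (qs : seq rat) (x : K) : R :=
  foldr (fun p acc => Num.min (ratr p.1 + n.+1%:R * D x p.2) acc)
        (ratr q0) (zip qs s).

Let mcshane_continuous s n q0 qs : continuous (mcshane s n q0 qs).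
Proof.
rewrite /mcshane; elim: (zip qs s) => [|p l IH] /=; first exact: continuous_cst.
apply: continuous_minr => // x; apply: cvgD; first exact: cvg_cst.
have cDp : continuous (fun y => D y p.2).
  by rewrite (_ : (fun y => D y p.2) = D p.2)//; apply/funext => y; rewrite Dsym.
by apply: cvgMr; exact: cDp.
Qed.

Lemma separable_continuous : exists e : nat -> K -> R,
  (forall n, continuous (e n)) /\
  forall f : K -> R, continuous f -> forall eps : R, 0 < eps ->
    exists n, forall x, `|f x - e n x| <= eps.
Proof.
(* The mesh is the square of [1 / (n + 1)], so that the slope [n + 1] of [mcshane] times the mesh is
   still [1 / (n + 1)]. *)
have /choice[s Hs] : forall n : nat, exists s : seq K, forall x,
    exists2 w, w \in s & D x w < n.+1%:R^-1 * n.+1%:R^-1.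
  by move=> n; apply: D_net; rewrite mulr_gt0// invr_gt0.
exists (fun k => match unpickle k with
  | Some (n, q0, qs) => mcshane (s n) n q0 qs
  | None => fun=> 0 end).
split=> [k|f cf eps eps0].
  by case: (unpickle k) => [[[n q0] qs]|]; [exact: mcshane_continuous|exact: continuous_cst].
have e40 : 0 < eps / 4 by rewrite divr_gt0.
have [M M0 HM] := continuous_compact_ubound cK f cf.
have [d d0 Hd] := metric_uniform_continuous f _ cf e40.
(* [q0] is the value of the empty minimum; lying above the bound [M], it never undercuts [f]. *)
have [q0 Hq0] : exists q : rat, M <= ratr q.
  have [|q] := @rat_in_itvoo R M (M + 1); first by rewrite ltrDl.
  by rewrite in_itv/= => /andP[/ltW ? _]; exists q.
have /choice[q Hq] : forall w, exists q : rat, `|ratr q - f w| <= eps / 4.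
  move=> w; have [|q] := @rat_in_itvoo R (f w) (f w + eps / 4); first by rewrite ltrDl.
  rewrite in_itv/= => /andP[H1 H2]; exists q.
  by rewrite ger0_norm; lra.
(* A sum in place of a maximum. Its terms make [1 / (n + 1)] smaller than [eps / 4] and than [d],
   and make the slope large enough that a net point at distance at least [d] already costs [2 * M],
   hence cannot pull the minimum far below [f x]. *)
pose A := (eps / 4)^-1 + d^-1 + (2 * M) / d.
have [n Hn] : exists n : nat, A < n.+1%:R.
  by exists (Num.truncn A); exact: truncnS_gt.
have A1 : 0 < (eps / 4)^-1 by rewrite invr_gt0.
have A2 : 0 < d^-1 by rewrite invr_gt0.
have A3 : 0 < 2 * M / d by rewrite divr_gt0// mulr_gt0.
have n0 : 0 < n.+1%:R :> R by rewrite ltr0n.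
have ne : n.+1%:R^-1 < eps / 4.
  by rewrite invf_plt ?posrE//; apply: lt_trans Hn; rewrite /A; lra.
have nd : n.+1%:R^-1 < d.
  by rewrite invf_plt ?posrE//; apply: lt_trans Hn; rewrite /A; lra.
have nM : 2 * M <= n.+1%:R * d.
  by rewrite -ler_pdivrMr//; apply: ltW; apply: lt_trans Hn; rewrite /A; lra.
exists (pickle (n, q0, map q (s n))) => x; rewrite pickleK.
rewrite /mcshane (_ : zip (map q (s n)) (s n) = map (fun w => (q w, w)) (s n)); last first.
  by elim: (s n) => //= w l ->.
rewrite foldr_map/=; set F := foldr _ _ _.
have Fge c : c <= ratr q0 ->
    (forall w, c <= ratr (q w) + n.+1%:R * D x w) -> c <= F.
  by rewrite /F => c0 Hc; elim: (s n) => //= w l IH; rewrite le_min Hc IH.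
have Fle w : w \in s n -> F <= ratr (q w) + n.+1%:R * D x w.
  rewrite /F; elim: (s n) => //= v l IH; rewrite inE => /orP[/eqP->|/IH H].
    by rewrite ge_min lexx.
  by rewrite ge_min H orbT.
have fxM : `|f x| <= M := HM x.
rewrite distrC ler_distl; apply/andP; split.
  apply: Fge.
    apply: le_trans Hq0; move: fxM; rewrite ler_norml => /andP[]; lra.
  move=> w; have := Hq w; rewrite ler_norml => /andP[q1 q2].
  have nD : 0 <= n.+1%:R * D x w by rewrite mulr_ge0.
  have [Dd|dD] := ltP (D x w) d.
    by have := Hd _ _ Dd; rewrite ltr_norml => /andP[]; lra.
  have : n.+1%:R * d <= n.+1%:R * D x w by rewrite ler_wpM2l.
  have := HM w; rewrite ler_norml => /andP[].
  move: fxM; rewrite ler_norml => /andP[]; lra.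
have [w ws Dw] := Hs n x.
apply: (le_trans (Fle w ws)).
have := Hq w; rewrite ler_norml => /andP[q1 q2].
have H1 : n.+1%:R * D x w < n.+1%:R^-1 by rewrite -ltr_pdivlMl.
have n1 : n.+1%:R^-1 <= 1 :> R by rewrite invf_le1// ler1n.
have Dd : D x w < d.
  apply: lt_trans nd; apply: lt_le_trans Dw _.
  by rewrite ger_pMr ?invr_gt0.
have := Hd _ _ Dd; rewrite ltr_norml => /andP[].
move: q2 H1 ne; set u := ratr _; set v := _ * D x w.
move: (f x) (f w) n.+1%:R^-1 => fx fw z; clearbody u v; lra.
Qed.

End CompactMetrizable.

(** * The suspension space and its flow *)

Section SuspensionSpace.
Context {R : realType} {X : pmetricType R} (T : X -> X) (tau : X -> R)
  (htau : forall x, 0 < tau x).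
Local Notation K := (Xtau T tau htau).

(** A retraction of the whole product onto the region below the roof. It makes [susp_pt] total, so
    that continuity can be stated on [X * R] instead of a subspace. *)
Definition clampY (p : X * R) : X * R :=
  (p.1, Num.min (tau p.1) (Num.max 0 p.2)).

Lemma clampY_in p : clampY p \in Ydom tau.
Proof.
apply/mem_set; rewrite /Ydom /clampY /=.
by rewrite le_min (ltW (htau _)) le_max lexx/= ge_min lexx.
Qed.

Lemma clampY_id p : Ydom tau p -> clampY p = p.
Proof.
by case: p => x s /= /andP[s0 st]; rewrite /clampY/= (max_idPr s0) (min_idPr st).
Qed.

Definition susp_pt (p : X * R) : K :=
  \pi_K (exist (fun p => p \in Ydom tau) (clampY p) (clampY_in p)).

Lemma susp_pt_eq p q : Ydom tau p -> Ydom tau q ->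
  Defs.canon T tau p = Defs.canon T tau q -> susp_pt p = susp_pt q.
Proof.
move=> Yp Yq pq; apply/eqmodP; rewrite /= /susp_rel /=.
by rewrite !clampY_id// pq.
Qed.

Lemma susp_pt_pi (y : set_type (Ydom tau)) : susp_pt (val y) = \pi_K y.
Proof.
rewrite /susp_pt; congr (\pi_K _); apply/val_inj => /=.
by rewrite clampY_id//; apply/set_mem; exact: valP.
Qed.

Lemma susp_pt_repr (z : K) : susp_pt (val (repr z)) = z.
Proof. by rewrite susp_pt_pi reprK. Qed.

Lemma susp_pt_roof x : susp_pt (x, tau x) = susp_pt (T x, 0).
Proof.
have t0 := ltW (htau x).
apply: susp_pt_eq; rewrite /Ydom/= ?lexx ?t0 ?(ltW (htau _))//.
by rewrite /Defs.canon/= eqxx eq_sym gt_eqF.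
Qed.

Lemma susp_pt_canon (z : K) :
  exists x s, [/\ z = susp_pt (x, s), 0 <= s & s < tau x].
Proof.
rewrite -(susp_pt_repr z); case: (repr z) => -[x s] /= /set_mem/= /andP[s0 st].
have [->|sx] := eqVneq s (tau x).
  by exists (T x), 0; rewrite susp_pt_roof.
by exists x, s; split => //; rewrite lt_neqAle sx.
Qed.

(** Functions on the quotient are built this way: if [E] respects the identification, the
    representative chosen by [repr] does not matter. *)
Lemma lift_susp_pt (E : X * R -> R) : (forall x, E (x, tau x) = E (T x, 0)) ->
  forall p, E (val (repr (susp_pt p))) = E (clampY p).
Proof.
move=> HE p; have Ec q : E (Defs.canon T tau q) = E q.
  by case: q => x s; rewrite /Defs.canon /=; case: eqP => [->|//]; rewrite HE.
rewrite -Ec -[RHS]Ec; congr E; apply/eqP.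
have /eqmodP : susp_pt p = susp_pt (val (repr (susp_pt p))) by rewrite susp_pt_repr.
have Yr : Ydom tau (val (repr (susp_pt p))) by apply/set_mem; exact: valP.
by rewrite /= /susp_rel /= (clampY_id _ Yr) eq_sym.
Qed.

Hypothesis cX : compact [set: X].
Hypothesis cT : continuous T.
Hypothesis ctau : continuous tau.

Lemma clampY_continuous : continuous clampY.
Proof.
have ct : continuous (fun p : X * R => tau p.1).
  by move=> q; apply: continuous_comp; [exact: cvg_fst|exact: ctau].
have cs : continuous (fun p : X * R => Num.min (tau p.1) (Num.max 0 p.2)).
  apply: continuous_minr => //; apply: continuous_maxr; first exact: continuous_cst.
  by move=> q; exact: cvg_snd.
by move=> p; exact: cvg_pair cvg_fst (cs p).
Qed.

Lemma susp_pt_continuous : continuous susp_pt.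
Proof.
apply/continuousP => A oA.
have : open (\pi_K @^-1` A : set (set_type (Ydom tau))) by exact: oA.
move=> [V oV VA].
rewrite (_ : susp_pt @^-1` A = clampY @^-1` V).
  by move/continuousP : clampY_continuous; apply.
apply/funext => p.
rewrite -[RHS]/((set_val @^-1` V) (exist (fun p => p \in Ydom tau) _ (clampY_in p))).
by rewrite VA.
Qed.

Lemma susp_pt_quotient (Z : topologicalType) (f : K -> Z) :
  continuous (f \o susp_pt) -> continuous f.
Proof.
move=> /continuousP cf; apply/continuousP => A oA.
suff : open (\pi_K @^-1` (f @^-1` A) : set (set_type (Ydom tau))) by [].
exists ((f \o susp_pt) @^-1` A); first exact: cf.
by apply/funext => y; rewrite /preimage/= susp_pt_pi.
Qed.

Lemma Xtau_compact : compact [set: K].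
Proof.
have [M M0 HM] := continuous_compact_ubound cX tau ctau.
have -> : [set: K] = susp_pt @` ([set: X] `*` `[0, M]).
  apply/seteqP; split => // z _.
  have [x [s [-> s0 st]]] := susp_pt_canon z; exists (x, s) => //=.
  split => //=; rewrite in_itv/= s0/= (le_trans (ltW st))//.
  exact: le_trans (ler_norm _) (HM x).
apply: continuous_compact.
  exact: continuous_subspaceT susp_pt_continuous.
by apply: compact_setX => //; exact: segment_compact.
Qed.

Lemma mdist_continuous (x : X) : continuous (mdist x : X -> R).
Proof.
move=> y; apply/cvgrPdist_lt => e e0.
have : nbhs y (ball y e) by exact: nbhsx_ballx.
apply: filterS => z; rewrite ballEmdist/= => yz.
rewrite ltr_norml; have := metric_triangle x y z; have := metric_triangle x z y.
rewrite (metric_sym z y); lra.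
Qed.

(** The height relative to the roof. In this coordinate the identification glues level 1 over [x] to
    level 0 over [T x], whatever [tau x] is. *)
Definition susp_ratio (p : X * R) : R := (clampY p).2 / tau p.1.

Lemma susp_ratio01 p : 0 <= susp_ratio p <= 1.
Proof.
have := set_mem (clampY_in p); rewrite /Ydom/= => /andP[H1 H2].
rewrite /susp_ratio divr_ge0//=; last exact: ltW.
by rewrite ler_pdivrMr// mul1r.
Qed.

Lemma susp_ratio_continuous : continuous susp_ratio.
Proof.
move=> p; apply: cvgM.
  by apply: continuous_comp; [exact: clampY_continuous|exact: cvg_snd].
apply: cvgV; first by rewrite gt_eqF.
by apply: continuous_comp; [exact: cvg_fst|exact: ctau].
Qed.

(* A continuous pseudometric on [X * R]; it does not respect the identification,
   but the functions on [Xtau] that are 1-Lipschitz for it separate points. *)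
Definition height_dist (p q : X * R) : R :=
  `|susp_ratio p - susp_ratio q| + mdist p.1 q.1 + mdist (T p.1) (T q.1).

Lemma height_dist_continuous p : continuous (height_dist p).
Proof.
have cd (f : X * R -> X) (y : X) : continuous f -> continuous (fun q => mdist y (f q)).
  by move=> cf q; apply: continuous_comp; [exact: cf|exact: mdist_continuous].
move=> q; apply: cvgD; last first.
  apply: cd => q'; apply: continuous_comp; [exact: cvg_fst|exact: cT].
apply: cvgD; last by apply: cd => q'; exact: cvg_fst.
by apply: cvg_norm; apply: cvgB; [exact: cvg_cst|exact: susp_ratio_continuous].
Qed.

Lemma height_dist_bounded : exists M : R, forall p q, height_dist p q <= M.
Proof.
have [M M0 HM] := continuous_compact_ubound cX _ (mdist_continuous point).
have dM (x y : X) : mdist x y <= M + M.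
  apply: le_trans (metric_triangle x point y) _; rewrite (metric_sym x).
  by apply: lerD; apply: le_trans (HM _); exact: ler_norm.
exists (1 + (M + M) + (M + M)) => p q; rewrite !lerD//.
have := susp_ratio01 p; have := susp_ratio01 q; rewrite ler_norml; lra.
Qed.

Definition height_lipschitz (c : R) (e : K -> R) :=
  forall p q, `|e (susp_pt p) - e (susp_pt q)| <= c * height_dist p q.

(** The largest pseudometric on the quotient dominated by [height_dist]. Symmetry, the triangle
    inequality and continuity come almost for free; only the separation of points takes work. *)
Definition susp_dist (z w : K) : R := sup [set `|e z - e w| | e in height_lipschitz 1].

Let susp_dist_has_sup z w : has_sup [set `|e z - e w| | e in height_lipschitz 1].
Proof.
have hd0 p q : 0 <= height_dist p q by rewrite !addr_ge0// mdist_ge0.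
split.
  by exists `|(0:R) - 0|; exists (fun=> 0) => // p q; rewrite subrr normr0 mul1r.
have [M HM] := height_dist_bounded.
exists M => _ [e He <-]; rewrite -(susp_pt_repr z) -(susp_pt_repr w).
by apply: le_trans (He _ _) _; rewrite mul1r.
Qed.

Let susp_dist_ub z w e : height_lipschitz 1 e -> `|e z - e w| <= susp_dist z w.
Proof. by move=> He; apply: sup_upper_bound => //; exists e. Qed.

Let susp_dist_le z w M : (forall e, height_lipschitz 1 e -> `|e z - e w| <= M) ->
  susp_dist z w <= M.
Proof.
move=> H; apply: ge_sup; first by have [] := susp_dist_has_sup z w.
by move=> _ [e He <-]; exact: H.
Qed.

Lemma susp_distxx z : susp_dist z z = 0.
Proof.
apply/eqP; rewrite eq_le; apply/andP; split.
  by apply: susp_dist_le => e _; rewrite subrr normr0.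
have /(susp_dist_ub z z) : height_lipschitz 1 (fun=> 0).
  by move=> p q; rewrite subrr normr0 mul1r !addr_ge0// mdist_ge0.
by rewrite subrr normr0.
Qed.

Lemma susp_dist_sym z w : susp_dist z w = susp_dist w z.
Proof.
by apply/eqP; rewrite eq_le; apply/andP; split; apply: susp_dist_le => e He;
  rewrite distrC; exact: susp_dist_ub.
Qed.

Lemma susp_dist_triangle z u w : susp_dist z w <= susp_dist z u + susp_dist u w.
Proof.
apply: susp_dist_le => e He.
rewrite (_ : e z - e w = (e z - e u) + (e u - e w)); last by ring.
by apply: le_trans (ler_normD _ _) _; apply: lerD; exact: susp_dist_ub.
Qed.

Lemma susp_dist_continuous z : continuous (susp_dist z).
Proof.
apply: susp_pt_quotient => p; apply/cvgrPdist_le => eps eps0.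
have : nbhs (height_dist p p) [set v | v < eps].
  apply: open_nbhs_nbhs; split; first exact: open_lt.
  by rewrite /= /height_dist !subrr !mdistxx normr0 !addr0.
move=> /(height_dist_continuous p p) => Hp; near=> q.
have /ltW Hq : height_dist p q < eps by near: q; exact: Hp.
have H u v : susp_dist (susp_pt u) (susp_pt v) <= height_dist u v.
  by apply: susp_dist_le => e He; apply: le_trans (He u v) _; rewrite mul1r.
have t1 := susp_dist_triangle z (susp_pt p) (susp_pt q).
have t2 := susp_dist_triangle z (susp_pt q) (susp_pt p).
rewrite (susp_dist_sym (susp_pt q)) in t2.
have := H p q; rewrite /= ler_norml; lra.
Unshelve. all: by end_near. Qed.

Let susp_dist0_eq c e z w : 0 < c -> height_lipschitz c e -> susp_dist z w = 0 ->
  e z = e w.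
Proof.
move=> c0 He zw.
have /(susp_dist_ub z w) : height_lipschitz 1 (fun z => c^-1 * e z).
  move=> p q; rewrite -mulrBr normrM gtr0_norm ?invr_gt0// mul1r.
  by rewrite ler_pdivrMl.
rewrite zw -mulrBr normrM pmulr_rle0 ?normr_gt0 ?invr_eq0 ?gt_eqF//.
by rewrite normr_le0 subr_eq0 => /eqP.
Qed.

Let susp_dist0_lift c (E : X * R -> R) x s x' s' : 0 < c ->
  (forall x, E (x, tau x) = E (T x, 0)) ->
  (forall p q, `|E (clampY p) - E (clampY q)| <= c * height_dist p q) ->
  0 <= s < tau x -> 0 <= s' < tau x' ->
  susp_dist (susp_pt (x, s)) (susp_pt (x', s')) = 0 -> E (x, s) = E (x', s').
Proof.
move=> c0 HE Hl /andP[s0 st] /andP[s0' st'] D0.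
have Y1 : Ydom tau (x, s) by rewrite /Ydom/= s0 ltW.
have Y2 : Ydom tau (x', s') by rewrite /Ydom/= s0' ltW.
rewrite -(clampY_id _ Y1) -(clampY_id _ Y2) -!lift_susp_pt//.
apply: (susp_dist0_eq c (fun z => E (val (repr z)))) D0 => // p q.
by rewrite !lift_susp_pt.
Qed.

Let susp_ratio_clamp p : susp_ratio (clampY p) = susp_ratio p.
Proof.
by rewrite /susp_ratio (clampY_id (clampY p))//; apply/set_mem; exact: clampY_in.
Qed.

Let susp_ratioE x s : 0 <= s <= tau x -> susp_ratio (x, s) = s / tau x.
Proof. by move=> H; rewrite /susp_ratio clampY_id. Qed.

Let susp_ratio_roof x : susp_ratio (x, tau x) = 1.
Proof. by rewrite susp_ratioE ?divff ?gt_eqF// lexx ltW. Qed.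

Let susp_ratio0 x : susp_ratio (x, 0) = 0.
Proof. by rewrite susp_ratioE ?mul0r// lexx ltW. Qed.

Let norm_mulB_le (a b a' b' A B : R) : `|b| <= B -> `|a'| <= A ->
  `|a * b - a' * b'| <= B * `|a - a'| + A * `|b - b'|.
Proof.
move=> bB aA; rewrite (_ : a * b - a' * b' = (a - a') * b + a' * (b - b')); last by ring.
apply: le_trans (ler_normD _ _) _; rewrite !normrM mulrC.
by apply: lerD; rewrite ler_wpM2r.
Qed.

(** At distance zero, all Lipschitz functions compatible with the identification agree. Multiples of
    [phi] vanish at both ends of a fibre, so they are compatible. Where [phi] is nonzero, [phi]
    together with its product with the ratio recovers the ratio, and [phi] times a distance recovers
    the base point. Points with ratio 0 are left to [W_eq]. *)
Lemma susp_dist_sep z w : susp_dist z w = 0 -> z = w.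
Proof.
have [M M0 dM] : exists2 M : R, 0 < M & forall x y : X, `|mdist x y| <= M.
  have [M M0 HM] := continuous_compact_ubound cX _ (mdist_continuous point).
  exists (M + M); first by rewrite addr_gt0.
  move=> x y; rewrite ger0_norm ?mdist_ge0//.
  apply: le_trans (metric_triangle x point y) _; rewrite (metric_sym x).
  by apply: lerD; apply: le_trans (HM _); exact: ler_norm.
have [x [s [-> s0 st]]] := susp_pt_canon z.
have [x' [s' [-> s0' st']]] := susp_pt_canon w.
move=> D0.
have Hs : 0 <= s < tau x by rewrite s0.
have Hs' : 0 <= s' < tau x' by rewrite s0'.
pose phi p := susp_ratio p * (1 - susp_ratio p).
have r1 p : `|susp_ratio p| <= 1.
  by have := susp_ratio01 p => /andP[? ?]; rewrite ger0_norm.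
have r1' p : `|1 - susp_ratio p| <= 1.
  by have := susp_ratio01 p => /andP[? ?]; rewrite ger0_norm; lra.
have hd p q : [/\ `|susp_ratio p - susp_ratio q| <= height_dist p q,
    mdist p.1 q.1 <= height_dist p q & mdist (T p.1) (T q.1) <= height_dist p q].
  have d1 := mdist_ge0 p.1 q.1; have d2 := mdist_ge0 (T p.1) (T q.1).
  have d3 := normr_ge0 (susp_ratio p - susp_ratio q).
  by rewrite /height_dist; split; lra.
have rB p q : `|(1 - susp_ratio p) - (1 - susp_ratio q)| = `|susp_ratio p - susp_ratio q|.
  by rewrite distrC; congr `|_|; ring.
have phi_lip p q : `|phi p - phi q| <= 2 * height_dist p q.
  apply: le_trans (norm_mulB_le _ _ _ _ 1 1 (r1' _) (r1 _)) _.
  by rewrite rB; have [? _ _] := hd p q; lra.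
have phi1 p : `|phi p| <= 1.
  by rewrite /phi normrM mulr_ile1.
have dB (a b y : X) : `|mdist a y - mdist b y| <= mdist a b.
  have := metric_triangle a b y; have := metric_triangle b a y.
  by rewrite (metric_sym b a) ler_norml; lra.
have phi_eq : phi (x, s) = phi (x', s').
  apply: (susp_dist0_lift 2) D0 => //.
  - by move=> y; rewrite /phi susp_ratio_roof susp_ratio0; ring.
  - by move=> p q; rewrite /phi !susp_ratio_clamp; exact: phi_lip.
have phi2_eq : susp_ratio (x, s) * phi (x, s) = susp_ratio (x', s') * phi (x', s').
  apply: (susp_dist0_lift 3 (fun p => susp_ratio p * phi p)) D0 => //.
  - by move=> y; rewrite /phi susp_ratio_roof susp_ratio0; ring.
  - move=> p q; rewrite /phi !susp_ratio_clamp.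
    apply: le_trans (norm_mulB_le _ _ _ _ 1 1 (phi1 _) (r1 _)) _.
    have := phi_lip p q; have [? _ _] := hd p q; rewrite /phi; lra.
have phid_eq y : phi (x, s) * mdist x y = phi (x', s') * mdist x' y.
  apply: (susp_dist0_lift (M * 2 + 1) (fun p => phi p * mdist p.1 y)) D0 => //.
  - by rewrite addr_gt0// mulr_gt0.
  - by move=> u; rewrite /phi susp_ratio_roof susp_ratio0; ring.
  - move=> p q; rewrite /phi !susp_ratio_clamp.
    apply: le_trans (norm_mulB_le _ _ _ _ 1 M (dM _ _) (phi1 _)) _.
    rewrite mulrDl -(mulrA M); apply: lerD.
      by apply: ler_wpM2l; [exact: ltW|exact: phi_lip].
    rewrite !mul1r; apply: le_trans (dB _ _ _) _.
    by have [_ ? _] := hd p q.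
(* Interpolating between the distances from [x] and from [T x] is compatible: at the roof only the
   second remains, which is the value at [(T x, 0)]. Its Lipschitz bound is the reason for the third
   term of [height_dist]. *)
have W_eq y : (1 - susp_ratio (x, s)) * mdist x y + susp_ratio (x, s) * mdist (T x) y =
    (1 - susp_ratio (x', s')) * mdist x' y + susp_ratio (x', s') * mdist (T x') y.
  apply: (susp_dist0_lift (M + 1 + (M + 1)) (fun p => (1 - susp_ratio p) * mdist p.1 y +
    susp_ratio p * mdist (T p.1) y)) D0 => //.
  - by rewrite !addr_gt0.
  - by move=> u; rewrite /= susp_ratio_roof susp_ratio0; ring.
  - move=> p q; rewrite !susp_ratio_clamp opprD addrACA.
    apply: le_trans (ler_normD _ _) _; rewrite [leRHS]mulrDl; apply: lerD.
      apply: le_trans (norm_mulB_le _ _ _ _ 1 M (dM _ _) (r1' _)) _.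
      rewrite rB mulrDl; have [h1 h2 _] := hd p q; apply: lerD.
        by rewrite ler_wpM2l// ltW.
      by rewrite !mul1r; apply: le_trans (dB _ _ _) _.
    apply: le_trans (norm_mulB_le _ _ _ _ 1 M (dM _ _) (r1 _)) _.
    rewrite mulrDl; have [h1 _ h2] := hd p q; apply: lerD.
      by rewrite ler_wpM2l// ltW.
    by rewrite !mul1r; apply: le_trans (dB _ _ _) _.
have RE : susp_ratio (x, s) = s / tau x by rewrite susp_ratioE// s0 ltW.
have RE' : susp_ratio (x', s') = s' / tau x' by rewrite susp_ratioE// s0' ltW.
have [t0 t0'] := (htau x, htau x').
have rlt : susp_ratio (x, s) < 1 by rewrite RE ltr_pdivrMr// mul1r.
have rlt' : susp_ratio (x', s') < 1 by rewrite RE' ltr_pdivrMr// mul1r.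
have [r0|rn0] := eqVneq (susp_ratio (x, s)) 0.
  have r0' : susp_ratio (x', s') = 0.
    move: phi_eq; rewrite /phi r0 mul0r => /esym/eqP; rewrite mulf_eq0.
    by rewrite subr_eq0 (gt_eqF rlt') orbF => /eqP.
  have xx : x = x'.
    have := W_eq x'; rewrite r0 r0' !mul0r !subr0 !mul1r !addr0 mdistxx.
    exact: mdist_positivity.
  have z0 y u : 0 < tau y -> u / tau y = 0 -> u = 0 :> R.
    by move=> ty /eqP; rewrite mulf_eq0 invr_eq0 (gt_eqF ty) orbF => /eqP.
  by rewrite (z0 _ _ t0 (etrans (esym RE) r0)) (z0 _ _ t0' (etrans (esym RE') r0')) xx.
have phin0 : phi (x, s) != 0.
  by rewrite /phi mulf_neq0// subr_eq0 gt_eqF.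
have rr : susp_ratio (x, s) = susp_ratio (x', s').
  by move: phi2_eq; rewrite -phi_eq => /(mulIf phin0).
have xx : x = x'.
  have := phid_eq x'; rewrite mdistxx mulr0 => /eqP; rewrite mulf_eq0 (negbTE phin0)/=.
  by move=> /eqP; exact: mdist_positivity.
move: rr; rewrite RE RE' -xx => /(mulIf _) ->//.
by rewrite invr_eq0 gt_eqF.
Qed.

Lemma Xtau_cozero (U : set K) : open U -> exists g : K -> R, cozero_spec U g.
Proof.
apply: (metric_cozero Xtau_compact susp_dist); [exact: susp_distxx|
  exact: susp_dist_sym|move=> x y z; exact: susp_dist_triangle|
  exact: susp_dist_sep|exact: susp_dist_continuous].
Qed.

Lemma Xtau_separable : exists e : nat -> K -> R,
  (forall n, continuous (e n)) /\
  forall f : K -> R, continuous f -> forall eps : R, 0 < eps ->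
    exists n, forall x, `|f x - e n x| <= eps.
Proof.
apply: (separable_continuous Xtau_compact susp_dist); [exact: susp_distxx|
  exact: susp_dist_sym|move=> x y z; exact: susp_dist_triangle|
  exact: susp_dist_sep|exact: susp_dist_continuous].
Qed.

End SuspensionSpace.

(** * Flow lines from the base and continuity of the flow *)

Section SuspensionFlow.
Context {R : realType} {X : pmetricType R} (T : X -> X) (tau : X -> R)
  (htau : forall x, 0 < tau x).
Local Notation K := (Xtau T tau htau).
Local Notation susp_pt := (susp_pt T tau htau).

Lemma birkS (f : X -> R) n x : birk T f n.+1 x = birk T f n x + f (iter n T x).
Proof. by rewrite /birk big_ord_recr. Qed.

Lemma birk0 (f : X -> R) x : birk T f 0 x = 0.
Proof. by rewrite /birk big_ord0. Qed.

Lemma birkD (f : X -> R) n m x :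
  birk T f (m + n) x = birk T f n x + birk T f m (iter n T x).
Proof.
elim: m => [|m IH]; first by rewrite birk0 addr0.
by rewrite addSn !birkS IH -addrA iterD.
Qed.

Lemma birk_ge0 n x : 0 <= birk T tau n x.
Proof. by apply: sumr_ge0 => i _; exact: ltW. Qed.

Lemma birk_tau_le n m x : (n <= m)%N -> birk T tau n x <= birk T tau m x.
Proof.
by move=> /subnK <-; rewrite birkD lerDl birk_ge0.
Qed.

Hypothesis cX : compact [set: X].
Hypothesis cT : continuous T.
Hypothesis ctau : continuous tau.

Lemma tau_lbound : exists2 c : R, 0 < c & forall x, c <= tau x.
Proof.
have [||c _ Hc] := @compact_EVT_min X R tau setT _ cX.
- by exists point.
- exact: continuous_subspaceT.
by exists (tau c) => // x; apply: Hc; rewrite inE.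
Qed.

Lemma birk_unbounded (A : R) : exists N, forall n x, (N <= n)%N -> A < birk T tau n x.
Proof.
have [c c0 Hc] := tau_lbound.
exists (Num.truncn (A / c)).+1 => n x Nn.
apply: lt_le_trans (birk_tau_le _ _ x Nn); set N := _.+1.
apply: (@lt_le_trans _ _ (N%:R * c)).
  by rewrite -ltr_pdivrMr// truncnS_gt.
rewrite /birk -[X in X%:R](card_ord N) mulr_natl -sumr_const.
by apply: ler_sum.
Qed.

Lemma birk_bracket x (r : R) : 0 <= r ->
  exists n, birk T tau n x <= r < birk T tau n.+1 x.
Proof.
move=> r0; have [N /(_ N x (leqnn N)) HN] := birk_unbounded r.
have ex : exists n, r < birk T tau n x by exists N.
case: (ex_minnP ex) => -[|n]; first by rewrite birk0 ltNge r0.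
move=> rn Hn; exists n; rewrite rn andbT leNgt; apply/negP => /Hn.
by rewrite ltnn.
Qed.

(** The flow line issued from the base point [(x, 0)]. Every point of the suspension lies on one,
    and there [theta] is translation of [r], so the case distinctions of [flow_rep] and [repr] are
    settled once. *)
Definition susp_orbit (x : X) (r : R) : K :=
  let n := [get n | birk T tau n x <= r < birk T tau n.+1 x] in
  susp_pt (iter n T x, r - birk T tau n x).

(* Both ends are closed thanks to the identification. *)
Lemma susp_orbitE n x r : birk T tau n x <= r <= birk T tau n.+1 x ->
  susp_orbit x r = susp_pt (iter n T x, r - birk T tau n x).
Proof.
move=> /andP[H1 H2]; have r0 : 0 <= r by exact: le_trans (birk_ge0 n x) H1.
rewrite /susp_orbit; set P := (X in xget _ X).
have /andP[m1 m2] : P (xget point P) := getPex (birk_bracket x r r0).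
set m := xget _ P in m1 m2 *.
have mn : (n <= m)%N.
  rewrite leqNgt; apply/negP => /(birk_tau_le _ _ x).
  by move=> /(lt_le_trans m2) /(le_lt_trans H1); rewrite ltxx.
move: mn; rewrite leq_eqVlt => /orP[/eqP->//|nm].
have rE : r = birk T tau n.+1 x.
  by apply/eqP; rewrite eq_le H2 (le_trans (birk_tau_le _ _ x nm)).
have mE : m = n.+1.
  apply/eqP; rewrite eqn_leq nm andbT leqNgt; apply/negP => nm'.
  have := birk_tau_le _ _ x nm'; rewrite birkS -rE => H.
  by have := htau (iter n.+1 T x); move: (le_trans H m1); rewrite gerDl; lra.
by rewrite mE rE subrr birkS addrAC subrr add0r susp_pt_roof.
Qed.

Lemma susp_orbit_iter n x r : 0 <= r ->
  susp_orbit (iter n T x) r = susp_orbit x (birk T tau n x + r).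
Proof.
move=> r0; have [m /andP[m1 /ltW m2]] := birk_bracket (iter n T x) r r0.
rewrite (susp_orbitE m) ?m1// (susp_orbitE (m + n)).
  by rewrite iterD birkD; congr (susp_pt (_, _)); ring.
by rewrite -addSn !birkD !lerD2l m1.
Qed.

Lemma susp_orbit_small x s : 0 <= s <= tau x -> susp_orbit x s = susp_pt (x, s).
Proof.
by move=> H; rewrite (susp_orbitE 0) birk0 ?subr0// birkS birk0 add0r.
Qed.

(** [theta] computes on the representative chosen by [repr], possibly the other end of a fibre;
    passing through [canon] removes that dependence. *)
Let orbit_canon (p : X * R) t : 0 <= t -> Ydom tau p ->
  susp_orbit p.1 (p.2 + t) =
  susp_orbit (Defs.canon T tau p).1 ((Defs.canon T tau p).2 + t).
Proof.
case: p => x s t0 _; rewrite /Defs.canon/=; case: eqP => [->|//].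
by rewrite /= add0r -[T x]/(iter 1 T x) susp_orbit_iter// birkS birk0 add0r.
Qed.

Lemma theta_susp_pt t x s : 0 <= t -> 0 <= s <= tau x ->
  theta T tau htau t (susp_pt (x, s)) = susp_orbit x (s + t).
Proof.
move=> t0 Hs; pose z := susp_pt (x, s).
have Yr : Ydom tau (val (repr z)) by apply/set_mem; exact: valP.
have Yp : Ydom tau (x, s) by [].
have cE : Defs.canon T tau (x, s) = Defs.canon T tau (val (repr z)).
  apply/eqP; have /eqmodP : susp_pt (x, s) = susp_pt (val (repr z)).
    by rewrite susp_pt_repr.
  by rewrite /= /susp_rel/= !clampY_id.
rewrite -[s + t]/((x, s).2 + t) -[x in RHS]/((x, s).1) orbit_canon// cE -orbit_canon//.
have [m /andP[m1 m2]] := birk_bracket (val (repr z)).1 _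
  (addr_ge0 (proj1 (andP Yr)) t0).
rewrite /theta -/z -susp_pt_pi.
rewrite /susp_orbit val_insubd.
set n := xget _ _.
(* [insubd] would return its default outside the region; the bracketing property of [n] places the
   new height between 0 and the roof. *)
rewrite /flow_rep -/n ifT//.
apply/mem_set; rewrite /Ydom /=.
rewrite /n; case: xgetP => [k _ /= /andP[k1 k2]|/(_ m)]; last by rewrite /= m1 m2.
by rewrite subr_ge0 k1/= lerBlDr [leRHS]addrC -birkS ltW.
Qed.

Lemma theta_susp_orbit t x r : 0 <= t -> 0 <= r ->
  theta T tau htau t (susp_orbit x r) = susp_orbit x (r + t).
Proof.
move=> t0 r0; have [m /andP[m1 m2]] := birk_bracket x r r0.
have H : 0 <= r - birk T tau m x <= tau (iter m T x).
  by rewrite subr_ge0 m1/= lerBlDr [leRHS]addrC -birkS ltW.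
rewrite (susp_orbitE m) ?m1 ?ltW// theta_susp_pt// susp_orbit_iter.
  by congr susp_orbit; ring.
by rewrite addr_ge0// subr_ge0.
Qed.

Lemma susp_orbit_surj (z : K) : exists x s, [/\ z = susp_orbit x s, 0 <= s & s < tau x].
Proof.
have [x [s [-> s0 st]]] := susp_pt_canon T tau htau z.
by exists x, s; rewrite susp_orbit_small// s0 ltW.
Qed.

Lemma iter_continuous n : continuous (iter n T).
Proof.
elim: n => [|n IH] x; first exact: cvg_id.
by apply: continuous_comp; [exact: IH|exact: cT].
Qed.

Lemma birk_continuous (f : X -> R) n : continuous f -> continuous (birk T f n).
Proof.
move=> cf; elim: n => [|n IH].
  rewrite (_ : birk T f 0 = fun=> 0); first exact: continuous_cst.
  by apply/funext => x; rewrite birk0.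
rewrite (_ : birk T f n.+1 = fun x => birk T f n x + f (iter n T x)).
  move=> x; apply: cvgD; first exact: IH.
  by apply: continuous_comp; [exact: iter_continuous|exact: cf].
by apply/funext => x; rewrite birkS.
Qed.

(** A pasting argument. Near [p] only the indices [k < N] occur, and on the closed piece [cond k]
    the orbit map is the continuous expression of index [k]. If [p] lies outside a piece, so do its
    neighbours; if [p] lies in several, the closed form of [susp_orbitE] makes the expressions agree
    at [p]. *)
Lemma susp_orbit_continuous :
  continuous (fun p : X * R => susp_orbit p.1 (Num.max 0 p.2)).
Proof.
have cm : continuous (fun p : X * R => Num.max 0 p.2).
  apply: continuous_maxr; first exact: continuous_cst.
  by move=> q; exact: cvg_snd.
have cb n : continuous (fun p : X * R => birk T tau n p.1).
  by move=> q; apply: continuous_comp; [exact: cvg_fst|exact: birk_continuous].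
have cdiff n : continuous (fun p : X * R => Num.max 0 p.2 - birk T tau n p.1).
  by move=> q; apply: cvgB; [exact: cm|exact: cb].
have ck k : continuous (fun p : X * R => susp_pt (iter k T p.1, Num.max 0 p.2 - birk T tau k p.1)).
  move=> q; apply: continuous_comp; last exact: susp_pt_continuous.
  have ci : continuous (fun p : X * R => iter k T p.1).
    by move=> q'; apply: continuous_comp; [exact: cvg_fst|exact: iter_continuous].
  exact: cvg_pair (ci q) (cdiff k q).
move=> p W HW.
pose cond k (q : X * R) := birk T tau k q.1 <= Num.max 0 q.2 <= birk T tau k.+1 q.1.
have [N HN] := birk_unbounded (Num.max 0 p.2).
have : \forall q \near p, forall k : 'I_N, cond k q ->
    W (susp_pt (iter k T q.1, Num.max 0 q.2 - birk T tau k q.1)).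
  pose G (k : 'I_N) : set (X * R) := fun q => cond k q ->
    W (susp_pt (iter k T q.1, Num.max 0 q.2 - birk T tau k q.1)).
  apply: (@filter_forall _ _ G _ (nbhs_filter p)) => k; rewrite /G; have [ckp|nckp] := boolP (cond k p).
    have : \forall q \near p, W (susp_pt (iter k T q.1, Num.max 0 q.2 - birk T tau k q.1)).
      by apply: (ck k p); move: HW; rewrite /= (susp_orbitE k).
    exact: filterS.
  have : \forall q \near p, ~~ cond k q.
    move: nckp; rewrite negb_and -!ltNge => /orP[H|H].
      have : nbhs (Num.max 0 p.2 - birk T tau k p.1) [set v | v < 0].
        by apply: open_nbhs_nbhs; split; [exact: open_lt|rewrite /= subr_lt0].
      move=> /(cdiff k p); apply: (@filterS _ _ (nbhs_filter p)) => q /=; rewrite subr_lt0 /cond => H'.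
      by rewrite leNgt H'.
    have : nbhs (Num.max 0 p.2 - birk T tau k.+1 p.1) [set v | 0 < v].
      by apply: open_nbhs_nbhs; split; [exact: open_gt|rewrite /= subr_gt0].
    move=> /(cdiff k.+1 p); apply: (@filterS _ _ (nbhs_filter p)) => q /=; rewrite subr_gt0 /cond => H'.
    by rewrite andbC leNgt H'.
  by apply: (@filterS _ _ (nbhs_filter p)) => q /negP.
have : nbhs (Num.max 0 p.2 - birk T tau N p.1) [set v | v < 0].
  by apply: open_nbhs_nbhs; split; [exact: open_lt|rewrite /= subr_lt0 HN].
move=> /(cdiff N p) H1 H2.
suff : \forall q \near p, W (susp_orbit q.1 (Num.max 0 q.2)) by [].
apply: (@filterS2 _ _ (nbhs_filter p) _ _ _ _ H1 H2) => q /= qN' Hq.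
have q0 : 0 <= Num.max 0 q.2 by rewrite le_max lexx.
have [k /andP[k1 k2]] := birk_bracket q.1 _ q0.
have qN : Num.max 0 q.2 < birk T tau N q.1.
  by rewrite -subr_lt0.
have kN : (k < N)%N.
  rewrite ltnNge; apply/negP => /(birk_tau_le _ _ q.1).
  by move=> /(lt_le_trans qN) /(le_lt_trans k1); rewrite ltxx.
rewrite /= (susp_orbitE k) ?k1 ?ltW//.
by apply: (Hq (Ordinal kN)); rewrite /cond/= k1 ltW.
Qed.

Lemma theta_continuous t : 0 <= t -> continuous (theta T tau htau t).
Proof.
move=> t0; apply: susp_pt_quotient.
rewrite (_ : _ \o _ = (fun p : X * R => susp_orbit p.1 (Num.max 0 p.2)) \o
    (fun p => ((clampY tau p).1, (clampY tau p).2 + t))).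
  have cc := clampY_continuous tau ctau.
  have c1 : continuous (fun q : X * R => (clampY tau q).1).
    by move=> q; exact: cvg_fst.
  have c2 : continuous (fun q : X * R => (clampY tau q).2 + t).
    move=> q; apply: cvgD (cvg_cst _).
    by apply: (@continuous_comp _ _ _ (clampY tau) snd); [exact: cc|exact: cvg_snd].
  move=> p; apply: continuous_comp; last exact: susp_orbit_continuous.
  exact: cvg_pair (c1 p) (c2 p).
apply/funext => p /=.
have Y : Ydom tau (clampY tau p) := set_mem (clampY_in tau htau p).
have -> : susp_pt p = susp_pt ((clampY tau p).1, (clampY tau p).2).
  rewrite -surjective_pairing.
  by congr (\pi_K _); apply/val_inj; rewrite /= (clampY_id tau (clampY tau p)).
rewrite theta_susp_pt// (max_idPr _)// addr_ge0//.
by case/andP: Y.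
Qed.

End SuspensionFlow.

(** * Birkhoff sums and specification *)

Section BirkhoffSums.
Context {R : realType} {X : pmetricType R} (T : X -> X).
Hypothesis cX : compact [set: X].

Lemma birk_norm_le (g : X -> R) M n x : (forall y, `|g y| <= M) ->
  `|birk T g n x| <= n%:R * M.
Proof.
move=> HM; elim: n => [|n IH]; first by rewrite birk0 normr0 mul0r.
rewrite birkS -natr1 mulrDl mul1r; apply: le_trans (ler_normD _ _) _.
exact: lerD.
Qed.

Lemma birk_ge_shadow (g : X -> R) (w : R) n x y :
  (forall p, (p < n)%N -> `|g (iter p T x) - g (iter p T y)| <= w) ->
  birk T g n y - n%:R * w <= birk T g n x.
Proof.
elim: n => [|n IH] H; first by rewrite !birk0 mul0r subrr.
have IHn := IH (fun p pn => H p (ltnW pn)).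
have := H n (ltnSn n); rewrite !birkS -natr1 mulrDl mul1r ler_norml => /andP[].
move: IHn; lra.
Qed.

(** If the claim failed at a positive length, all sums of that length would lie below [- w] times
    it. Cutting a long orbit segment into such blocks would then force a sum near [- w N], against
    the bound with [w / 2]. *)
Lemma birk_all_lengths (g : X -> R) (w : R) : continuous g -> 0 < w ->
  (forall N0, exists N y, (N0 <= N)%N /\ - (w / 2 * N%:R) <= birk T g N y) ->
  forall n, exists y, - (w * n%:R) <= birk T g n y.
Proof.
move=> cg w0 H [|n]; first by exists point; rewrite mulr0 oppr0 birk0.
have [M M0 HM] := continuous_compact_ubound cX g cg.
apply: contrapT => /forallNP Hlt.
have {}Hlt y : birk T g n.+1 y <= - (w * n.+1%:R).
  by have /negP := Hlt y; rewrite -ltNge => /ltW.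
have Hk k y : birk T g (k * n.+1) y <= - (w * (k * n.+1)%:R).
  elim: k y => [|k IH] y; first by rewrite mul0n birk0 mulr0 oppr0.
  by rewrite mulSn birkD natrD mulrDr opprD addrC lerD.
(* Beyond this [N], the incomplete last block, worth at most [(n + 1) (w + M)], is less than
   [w / 2 * N]. *)
pose A := 2 / w * (n.+1%:R * (w + M)).
have [N [y [NA HN]]] := H (Num.truncn A).+1.
have AN : A < N%:R.
  by apply: lt_le_trans (truncnS_gt A) _; rewrite ler_nat.
have NE := divn_eq N n.+1.
set k := (N %/ n.+1)%N in NE; set r := (N %% n.+1)%N in NE.
have rn : r%:R <= n.+1%:R :> R by rewrite ler_nat ltnW// ltn_pmod.
have H1 : birk T g N y <= - (w * (k * n.+1)%:R) + r%:R * M.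
  rewrite NE addnC birkD; apply: lerD; first exact: Hk.
  by apply: le_trans (ler_norm _) _; exact: birk_norm_le.
have NE' : N%:R = (k * n.+1)%:R + r%:R :> R by rewrite -natrD -NE.
have H2 : r%:R * (w + M) <= n.+1%:R * (w + M).
  by apply: ler_wpM2r => //; rewrite addr_ge0// ltW.
have H3 : n.+1%:R * (w + M) < w / 2 * N%:R.
  move: AN; rewrite /A -ltr_pdivlMl ?divr_gt0//.
  by rewrite invf_div.
have H4 : w * N%:R = w * (k * n.+1)%:R + w * r%:R by rewrite NE' mulrDr.
move: HN H1 H2 H3 H4; rewrite mulrDr (mulrC r%:R w).
move: (birk T g N y) (n.+1%:R * _) (r%:R * M) (w * r%:R) (w * _%:R) => B c d e f.
rewrite -[w / 2 * _]mulrAC; set u := w * N%:R; lra.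
Qed.

(** [m] is the gap demanded by specification at the chosen scale. The successor keeps the first
    phase, which starts at 0, from having length 0 when [C > 0]. *)
Fixpoint phase_start (C m j : nat) : nat :=
  if j is j'.+1 then
    (phase_start C m j' + C * (phase_start C m j').+1 + m)%N
  else 0%N.

Definition phase_length C m j := (C * (phase_start C m j).+1)%N.

(* The phases cycle through the three functions; each phase is at least [C]
   times as long as everything before it, so its own average dominates. *)
Lemma specification_oscillation (g : 'I_3 -> X -> R) (w : R) :
  continuous T -> specification T -> (forall i, continuous (g i)) -> 0 < w ->
  (forall i n, exists y, - (w * n%:R) <= birk T (g i) n y) ->
  exists z, forall i N0, exists2 N, (N0 < N)%N &
    - (3 * w * N%:R) <= birk T (g i) N z.
Proof.
move=> cT spec cg w0 Hy.
have [d d0 Hd] : exists2 d : R, 0 < d & forall i x y, mdist x y <= d ->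
    `|g i x - g i y| <= w.
  have : \forall d \near (0:R)^'+, forall i x y, mdist x y <= d ->
      `|g i x - g i y| <= w.
    apply: filter_forall => i.
    have [e e0 He] := metric_uniform_continuous cX mdist (@mdistxx _ X) (@metric_sym _ X)
      (@metric_triangle _ X) (@mdist_positivity _ X) mdist_continuous (g i) w (cg i) w0.
    near=> d => x y xy; apply/ltW/He/(le_lt_trans xy).
    by near: d; exact: nbhs_right_lt.
  move=> H; have [d [Hd d0]] := filter_ex (filterI H (nbhs_right_gt (0:R))).
  by exists d.
have [m Hm] := spec d d0.
have [M HM] : exists M : R, forall i x, `|g i x| <= M.
  have /choice[M HM] : forall i, exists M : R, forall x, `|g i x| <= M.
    by move=> i; have [M _ HM] := continuous_compact_ubound cX (g i) (cg i); exists M.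
  exists (\sum_i `|M i|) => i x; apply: le_trans (HM i x) _.
  apply: le_trans (ler_norm _) _.
  by rewrite (bigD1 i)//= lerDl sumr_ge0.
(* With [M <= w * C], the sum over everything before phase [j] is at most [w] times the length of
   that phase. *)
pose C := (Num.truncn (M / w)).+1.
have CM : M <= w * C%:R.
  by rewrite mulrC -ler_pdivrMr// ltW// truncnS_gt.
pose a := phase_start C m; pose L := phase_length C m.
pose idx (j : nat) : 'I_3 := inord (j %% 3).
have /choice[y yP] : forall j, exists y,
    - (w * (L j).+1%:R) <= birk T (g (idx j)) (L j).+1 y.
  by move=> j; exact: Hy.
have /choice[xk xkP] : forall k, exists x : X, forall j, (j < k)%N ->
    forall p, (p <= L j)%N -> mdist (iter (p + a j) T x) (iter p T (y j)) < d.
  move=> k; have [||x Hx] := Hm k a (fun j => (a j + L j)%N) y.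
  - by move=> j _; exact: leq_addr.
  - by move=> j _.
  by exists x => j jk p pL; apply: Hx => //; rewrite addKn.
(* Specification treats finitely many segments at a time. A cluster point of the points shadowing
   the first [k] phases shadows all of them, with the strict inequality weakened to a large one. *)
have [z [_ zcl]] := cX (xk @ \oo) _ (@filterT _ _ _).
have zP j p : (p <= L j)%N -> mdist (iter (p + a j) T z) (iter p T (y j)) <= d.
  move=> pL; rewrite leNgt; apply/negP => dz.
  have cm : continuous (fun x => mdist (iter (p + a j) T x) (iter p T (y j))).
    move=> x; rewrite (_ : (fun x => _) =
      (fun x => mdist (iter p T (y j)) (iter (p + a j) T x))).
      by apply: continuous_comp; [exact: iter_continuous|exact: mdist_continuous].
    by apply/funext => u; rewrite metric_sym.
  have B : nbhs z [set x | d < mdist (iter (p + a j) T x) (iter p T (y j))].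
    have : nbhs (mdist (iter (p + a j) T z) (iter p T (y j))) [set v | d < v].
      by apply: open_nbhs_nbhs; split; [exact: open_gt|].
    by move=> /cm.
  have A : (xk @ \oo) [set x | mdist (iter (p + a j) T x) (iter p T (y j)) < d].
    by exists j.+1 => // k /= jk; exact: xkP.
  by have [x [/= x1 /(lt_trans x1)]] := zcl _ _ A B; rewrite ltxx.
(* The residue of [j] modulo 3 selects [g i], and phase [j] starts at time [j] or later, hence not
   before [N0]. *)
exists z => i N0; pose j := (3 * N0 + i)%N.
have ij : idx j = i.
  by apply/val_inj; rewrite /= /idx inordK ?ltn_pmod// /j mulnC modnMDl modn_small.
have aj k : (k <= a k)%N.
  elim: k => // k IH; rewrite /a/= -/(a k) -addnA.
  by rewrite -[k.+1]addn1; apply: leq_add.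
exists (a j + (L j).+1)%N.
  rewrite addnS ltnS; apply: leq_trans (leq_addr _ _).
  by apply: leq_trans (aj j); rewrite /j mulSn -addnA leq_addr.
(* Three losses, each at most [w] times the total length: the past, the defect of [y j] itself, and
   the shadowing error. They make up the factor 3. *)
rewrite addnC birkD.
have H1 : - ((a j)%:R * M) <= birk T (g i) (a j) z.
  by have := birk_norm_le (g i) M (a j) z (HM i); rewrite ler_norml => /andP[].
have H2 : birk T (g i) (L j).+1 (y j) - (L j).+1%:R * w <=
    birk T (g i) (L j).+1 (iter (a j) T z).
  by apply: birk_ge_shadow => p pL; apply: Hd; rewrite -iterD; exact: zP.
have := yP j; rewrite ij => H3.
have aM : (a j)%:R * M <= w * (L j)%:R.
  rewrite /L /phase_length -/(a j) natrM mulrA mulrC.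
  apply: le_trans (_ : w * C%:R * (a j)%:R <= _).
    by rewrite ler_wpM2r.
  by rewrite ler_wpM2l ?ler_nat// mulr_ge0// ltW.
have N1 : w * (a j)%:R >= 0 by rewrite mulr_ge0// ltW.
have LS : (L j).+1%:R = (L j)%:R + 1 :> R by rewrite natr1.
rewrite natrD LS; rewrite LS in H2; rewrite LS in H3.
have E1 : 3 * w * ((L j)%:R + 1 + (a j)%:R) =
    3 * (w * (L j)%:R) + 3 * w + 3 * (w * (a j)%:R) by ring.
rewrite [X in _ - X]mulrDl (mulrC _ w) mul1r in H2.
rewrite mulrDr mulr1 in H3.
rewrite E1.
move: H1 H2 H3 aM N1.
move: (w * (L j)%:R) (w * (a j)%:R) (_ * M) => A B D.
move: (birk _ _ _ _) (birk _ _ _ _) (birk _ _ _ _) => u v t; lra.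
Unshelve. all: by end_near. Qed.

End BirkhoffSums.

(** * Time averages *)

Section IntervalIntegral.
Context {R : realType}.
Implicit Types g : R -> R.

Definition itvint g (a b : R) : R := Rintegral lebesgue_measure `[a, b] g.

Let mitv (a b : R) : measurable (`[a, b]%classic : set R).
Proof. exact: measurable_itv. Qed.

Lemma itvint_integrable g a b : continuous g ->
  (@lebesgue_measure R).-integrable `[a, b] (EFin \o g).
Proof.
move=> cg; apply: continuous_compact_integrable; first exact: segment_compact.
exact: continuous_subspaceT.
Qed.

Lemma itvint_eq g1 g2 a b : (forall u, a <= u <= b -> g1 u = g2 u) ->
  itvint g1 a b = itvint g2 a b.
Proof.
by move=> H; apply: eq_Rintegral => u; rewrite inE/= in_itv/= => /H.
Qed.

Lemma itvint_le g1 g2 a b : continuous g1 -> continuous g2 ->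
  (forall u, a <= u <= b -> g1 u <= g2 u) -> itvint g1 a b <= itvint g2 a b.
Proof.
by move=> c1 c2 H; apply: le_Rintegral => //; exact: itvint_integrable.
Qed.

Lemma itvint_cst c a b : a <= b -> itvint (fun=> c) a b = c * (b - a).
Proof.
move=> ab; rewrite /itvint Rintegral_cst//= lebesgue_measure_itv/= lte_fin.
by move: ab; rewrite le_eqVlt => /predU1P[->|->]; rewrite ?ltxx ?subrr// -EFinD.
Qed.

Lemma itvintD g1 g2 a b : continuous g1 -> continuous g2 ->
  itvint (fun u => g1 u + g2 u) a b = itvint g1 a b + itvint g2 a b.
Proof. by move=> c1 c2; apply: RintegralD => //; exact: itvint_integrable. Qed.

Lemma itvintZ c g a b : continuous g ->
  itvint (fun u => c * g u) a b = c * itvint g a b.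
Proof. by move=> cg; apply: RintegralZl => //; exact: itvint_integrable. Qed.

Lemma itvint_cat g a b c : continuous g -> a <= b -> b <= c ->
  itvint g a c = itvint g a b + itvint g b c.
Proof.
move=> cg ab bc; apply/eqP; rewrite addrC -subr_eq; apply/eqP.
rewrite /itvint Rintegral_itvB ?bnd_simp//; last exact: itvint_integrable.
rewrite Rintegral_itv_obnd_cbnd//.
apply: integrableS (itvint_integrable g b c cg) => //.
by apply: subset_itvr; rewrite bnd_simp.
Qed.

Lemma itvint_shift g s t : continuous g -> 0 <= t ->
  itvint (fun u => g (s + u)) 0 t = itvint g s (s + t).
Proof.
move=> cg t0; rewrite /itvint /Rintegral; congr fine; apply/esym.
pose F (u : R) := s + u.
have dF : derive1 F = fun=> 1.
  apply/funext => u; rewrite derive1E deriveD//= derive_cst derive_id add0r//.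
have := @integration_by_substitution_increasing R F g 0 t t0.
have F0 : F 0 = s by rewrite /F addr0.
rewrite F0 dF => ->.
- by apply: eq_integral => u _ /=; rewrite mulr1.
- by move=> u v _ _ uv; rewrite /F ltrD2l.
- by move=> u _; exact: cvg_cst.
- exact: is_cvg_cst.
- exact: is_cvg_cst.
- split.
  + by move=> u _; apply: derivableD.
  + by apply: cvg_at_right_filter; apply: cvgD; [exact: cvg_cst|exact: cvg_id].
  + by apply: cvg_at_left_filter; apply: cvgD; [exact: cvg_cst|exact: cvg_id].
- exact: continuous_subspaceT.
Qed.

Lemma itvint_dist g c e a b : continuous g -> a <= b ->
  (forall u, a <= u <= b -> `|g u - c| <= e) ->
  `|itvint g a b - c * (b - a)| <= e * (b - a).
Proof.
move=> cg ab H; rewrite ler_distl -mulrBl -mulrDl -!itvint_cst//.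
apply/andP; split; apply: itvint_le => //; try exact: continuous_cst;
  by move=> u /H; rewrite ler_distl => /andP[].
Qed.

Lemma itvint_norm_le g M a b : continuous g -> a <= b ->
  (forall u, `|g u| <= M) -> `|itvint g a b| <= M * (b - a).
Proof.
move=> cg ab H; have := itvint_dist g 0 M a b cg ab.
by rewrite mul0r subr0; apply => u _; rewrite subr0.
Qed.

End IntervalIntegral.

Lemma continuous_linr {R : realType} {K : topologicalType} (a : R) (f g : K -> R) :
  continuous f -> continuous g -> continuous (fun x => a * f x + g x).
Proof.
by move=> cf cg x; apply: cvgD (cg x); apply: cvgMr; exact: cf.
Qed.

(** * Time averages as integrals along flow lines *)

Section SuspensionAverages.
Context {R : realType} {X : pmetricType R} (T : X -> X) (tau : X -> R)
  (htau : forall x, 0 < tau x).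
Local Notation K := (Xtau T tau htau).
Local Notation susp_orbit := (susp_orbit T tau htau).
Hypothesis cX : compact [set: X].
Hypothesis cT : continuous T.
Hypothesis ctau : continuous tau.
Implicit Type f : K -> R.

Let cK := Xtau_compact T tau htau cX ctau.

(** Truncating the time at 0 gives a function continuous on the whole line, as the interval lemmas
    require. *)
Definition orbit_fun f (x : X) (r : R) : R := f (susp_orbit x (Num.max 0 r)).

Lemma orbit_fun_ge0 f x r : 0 <= r -> orbit_fun f x r = f (susp_orbit x r).
Proof. by move=> r0; rewrite /orbit_fun (max_idPr r0). Qed.

Lemma orbit_fun_continuous2 f : continuous f ->
  continuous (fun p : X * R => orbit_fun f p.1 p.2).
Proof.
move=> cf p; apply: continuous_comp; last exact: cf.
exact: susp_orbit_continuous.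
Qed.

Lemma orbit_fun_continuous f x : continuous f -> continuous (orbit_fun f x).
Proof.
move=> cf r.
apply: (@continuous_comp _ _ _ (fun r : R => (x, r)) (fun p : X * R => orbit_fun f p.1 p.2)).
  exact: cvg_pair (cvg_cst x) cvg_id.
exact: orbit_fun_continuous2.
Qed.

Let orbit_fun_near f x r (e : R) : continuous f -> 0 < e ->
  exists2 d : R, 0 < d & forall y u, mdist x y < d -> `|r - u| < d ->
    `|orbit_fun f x r - orbit_fun f y u| < e.
Proof.
move=> cf e0.
have : nbhs (orbit_fun f x r) [set v | `|orbit_fun f x r - v| < e].
  by have := nbhsx_ballx (orbit_fun f x r) e e0.
move=> /(orbit_fun_continuous2 f cf (x, r)) [[A B] /= [xA rB] AB].
have [d1 /= d10 H1] : exists2 d : R, 0 < d & ball x d `<=` A.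
  by move: xA; rewrite -nbhs_ballE => -[d d0 H]; exists d.
have [d2 /= d20 H2] : exists2 d : R, 0 < d & ball r d `<=` B.
  by move: rB; rewrite -nbhs_ballE => -[d d0 H]; exists d.
exists (Num.min d1 d2); first by rewrite lt_min d10.
move=> y u; rewrite !lt_min => /andP[xy _] /andP[_ ru].
apply: (AB (y, u)); split => /=; last exact: H2.
by apply: H1; rewrite ballEmdist.
Qed.

Lemma orbit_fun_equicontinuous f x (M e : R) : continuous f -> 0 < e ->
  \forall y \near x, forall u, 0 <= u <= M -> `|orbit_fun f x u - orbit_fun f y u| < e.
Proof.
move=> cf e0.
have cI : compact (`[0, M]%classic : set R) by exact: segment_compact.
have : \forall y \near x, (`[0, M]%classic : set R) `<=`
    (fun u => `|orbit_fun f x u - orbit_fun f y u| < e).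
  move/compact_near_coveringP : cI; apply => u0 _.
  have e20 : 0 < e / 2 by rewrite divr_gt0.
  have [d d0 Hd] := orbit_fun_near f x u0 _ cf e20.
  exists (ball u0 d, ball x d); first by split; exact: nbhsx_ballx.
  move=> [u y] /= [uu0]; rewrite ballEmdist/= => xy.
  have H1 := Hd y u xy uu0.
  have H2 := Hd x u; rewrite mdistxx in H2; have {}H2 := H2 d0 uu0.
  move: H1 H2; rewrite !ltr_norml => /andP[? ?] /andP[? ?]; apply/andP; split; lra.
by apply: filterS => y Hy u Hu; apply: Hy; rewrite /= in_itv.
Qed.

(** With [M] above the roof, the range of [s] reaches every point of the suspension, so this bounds
    the variation of [f] over short flow times uniformly; it controls Riemann sums. *)
Lemma orbit_fun_modulus f (M e : R) : continuous f -> 0 < e ->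
  exists2 d : R, 0 < d & forall x s u, 0 <= s <= M -> 0 <= u <= d ->
    `|orbit_fun f x (s + u) - orbit_fun f x s| < e.
Proof.
move=> cf e0.
have cI : compact ([set: X] `*` (`[0, M]%classic : set R)).
  by apply: compact_setX => //; exact: segment_compact.
have : \forall d \near (0:R)^'+, ([set: X] `*` (`[0, M]%classic : set R)) `<=`
    (fun p => forall u, 0 <= u <= d ->
      `|orbit_fun f p.1 (p.2 + u) - orbit_fun f p.1 p.2| < e).
  move/compact_near_coveringP : cI; apply => -[x0 s0] _.
  have e20 : 0 < e / 2 by rewrite divr_gt0.
  have [d d0 Hd] := orbit_fun_near f x0 s0 _ cf e20.
  have d20 : 0 < d / 2 by rewrite divr_gt0.
  exists (ball (x0, s0) (d / 2), [set r | 0 < r < d / 2]).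
    split; first exact: nbhsx_ballx.
    by near=> r => /=; apply/andP; split;
      near: r; [exact: nbhs_right_gt|exact: nbhs_right_lt].
  move=> [[x s] r] /= [[/= xx0 ss0]] /andP[r0 rd] u /andP[u0 ur].
  move: xx0; rewrite ballEmdist/= => xx0.
  have xd : mdist x0 x < d by lra.
  have ss0' : `|s0 - s| < d / 2 by [].
  have H1 : `|orbit_fun f x0 s0 - orbit_fun f x s| < e / 2.
    by apply: Hd => //; lra.
  have H2 : `|orbit_fun f x0 s0 - orbit_fun f x (s + u)| < e / 2.
    apply: Hd => //; move: ss0'; rewrite !ltr_norml => /andP[? ?]; apply/andP; split; lra.
  move: H1 H2; rewrite !ltr_norml => /andP[? ?] /andP[? ?]; apply/andP; split; lra.
move=> H; have [d [Hd d0]] := filter_ex (filterI H (nbhs_right_gt (0:R))).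
by exists d => // x s u Hs Hu; apply: (Hd (x, s)).
Unshelve. all: by end_near. Qed.

Definition roof_integral f (x : X) : R := itvint (orbit_fun f x) 0 (tau x).

Lemma orbit_fun_iter f n x u : 0 <= u ->
  orbit_fun f (iter n T x) u = orbit_fun f x (birk T tau n x + u).
Proof.
move=> u0; rewrite !orbit_fun_ge0 ?susp_orbit_iter//.
by rewrite addr_ge0// birk_ge0.
Qed.

(** At the times when the orbit returns to the base, Birkhoff sums and flow integrals match without
    boundary terms. *)
Lemma birk_roof_integral f n x : continuous f ->
  birk T (roof_integral f) n x = itvint (orbit_fun f x) 0 (birk T tau n x).
Proof.
move=> cf; have cF y := orbit_fun_continuous f y cf.
elim: n => [|n IH].
  by rewrite !birk0 /itvint set_itv1 Rintegral_set1.
rewrite !birkS IH (itvint_cat _ 0 (birk T tau n x) (_ + _))//.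
- rewrite -itvint_shift//; last exact: ltW.
  by congr (_ + _); apply: itvint_eq => u /andP[u0 _]; rewrite orbit_fun_iter.
- exact: birk_ge0.
- by rewrite lerDl ltW.
Qed.

Lemma tavg_susp_orbit f x s t : continuous f -> 0 <= s -> 0 <= t ->
  tavg T tau htau f (susp_orbit x s) t = t^-1 * itvint (orbit_fun f x) s (s + t).
Proof.
move=> cf s0 t0; rewrite /tavg -itvint_shift//; last exact: orbit_fun_continuous.
congr (_ * _); apply: itvint_eq => u /andP[u0 _].
by rewrite theta_susp_orbit// orbit_fun_ge0// addr_ge0.
Qed.

Lemma roof_integral_continuous f : continuous f -> continuous (roof_integral f).
Proof.
move=> cf x; apply/cvgrPdist_le => e e0.
have cF y := orbit_fun_continuous f y cf.
have [M M0 HM] := continuous_compact_ubound cK f cf.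
have FM y u : `|orbit_fun f y u| <= M by exact: HM.
have tx := htau x; have ty := htau.
have e1 : 0 < e / 2 / tau x by rewrite !divr_gt0.
have e2 : 0 < e / 2 / M by rewrite !divr_gt0.
have H2 : \forall y \near x, `|tau x - tau y| < e / 2 / M.
  by have /cvgrPdist_lt := ctau x; apply.
have H1 := orbit_fun_equicontinuous f x (tau x) _ cf e1.
near=> y.
have h1 : forall u, 0 <= u <= tau x ->
  `|orbit_fun f x u - orbit_fun f y u| < e / 2 / tau x by near: y.
have h2 : `|tau x - tau y| < e / 2 / M by near: y.
have A1 : `|itvint (orbit_fun f x) 0 (tau x) - itvint (orbit_fun f y) 0 (tau x)| <= e / 2.
  have cN : continuous (fun u => -1 * orbit_fun f y u).
    by move=> u; apply: cvgMr; exact: cF.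
  have cd : continuous (fun u => orbit_fun f x u + -1 * orbit_fun f y u).
    by move=> u; exact: cvgD (cF x u) (cN u).
  have := itvint_dist (fun u => orbit_fun f x u + -1 * orbit_fun f y u) 0
    (e / 2 / tau x) 0 (tau x) cd (ltW tx).
  rewrite mul0r !subr0 divfK ?gt_eqF// itvintD// itvintZ// mulN1r; apply.
  by move=> u /h1 /ltW; rewrite subr0 mulN1r.
have A2 : `|itvint (orbit_fun f y) 0 (tau x) - itvint (orbit_fun f y) 0 (tau y)| <= e / 2.
  have small : M * `|tau x - tau y| <= e / 2.
    by rewrite mulrC -ler_pdivlMr// ltW.
  apply: le_trans small; have [xy|yx] := leP (tau x) (tau y).
    rewrite (itvint_cat _ 0 (tau x) (tau y))// ?(ltW tx)// opprD addrA subrr add0r normrN.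
    have -> : `|tau x - tau y| = tau y - tau x by rewrite distrC ger0_norm ?subr_ge0.
    exact: itvint_norm_le.
  rewrite (itvint_cat _ 0 (tau y) (tau x)) ?(ltW (ty _)) ?(ltW yx)// addrAC subrr add0r.
  have -> : `|tau x - tau y| = tau x - tau y by rewrite ger0_norm ?subr_ge0 ?ltW.
  by apply: itvint_norm_le => //; exact: ltW.
rewrite /roof_integral [e]splitr.
rewrite (_ : _ - _ = (itvint (orbit_fun f x) 0 (tau x) - itvint (orbit_fun f y) 0 (tau x)) +
  (itvint (orbit_fun f y) 0 (tau x) - itvint (orbit_fun f y) 0 (tau y))); last by ring.
by apply: le_trans (ler_normD _ _) _; exact: lerD.
Unshelve. all: by end_near. Qed.

Lemma tavg_norm_le f M z t : continuous f -> (forall z, `|f z| <= M) -> 0 < t ->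
  `|tavg T tau htau f z t| <= M.
Proof.
move=> cf HM t0; have [x [s [-> s0 _]]] := susp_orbit_surj T tau htau cX ctau z.
rewrite tavg_susp_orbit ?(ltW t0)// normrM gtr0_norm ?invr_gt0//.
rewrite ler_pdivrMl// mulrC.
have := itvint_norm_le _ M s (s + t) (orbit_fun_continuous f x cf).
by rewrite addrAC subrr add0r lerDl; apply; [exact: ltW|move=> u; exact: HM].
Qed.

Lemma tavg_lin (a : R) f g z t : continuous f -> continuous g -> 0 <= t ->
  tavg T tau htau (fun z => a * f z + g z) z t =
  a * tavg T tau htau f z t + tavg T tau htau g z t.
Proof.
move=> cf cg t0; have [x [s [-> s0 _]]] := susp_orbit_surj T tau htau cX ctau z.
have cl := continuous_linr a f g cf cg.
rewrite !tavg_susp_orbit//.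
have cF := orbit_fun_continuous f x cf; have cG := orbit_fun_continuous g x cg.
rewrite -[orbit_fun (fun z => _) x]/(fun u => a * orbit_fun f x u + orbit_fun g x u).
rewrite itvintD//; last by move=> u; apply: cvgMr; exact: cF.
by rewrite itvintZ//; ring.
Qed.

Lemma tavg_le f g z t : continuous f -> continuous g -> 0 <= t ->
  (forall z, f z <= g z) -> tavg T tau htau f z t <= tavg T tau htau g z t.
Proof.
move=> cf cg t0 fg; have [x [s [-> s0 _]]] := susp_orbit_surj T tau htau cX ctau z.
rewrite !tavg_susp_orbit// ler_wpM2l ?invr_ge0//.
apply: itvint_le; [exact: orbit_fun_continuous..|].
by move=> u _; exact: fg.
Qed.

Lemma tavg_cst (c : R) z t : 0 < t -> tavg T tau htau (fun=> c) z t = c.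
Proof.
move=> t0; have [x [s [-> s0 _]]] := susp_orbit_surj T tau htau cX ctau z.
rewrite (tavg_susp_orbit _ x s t (continuous_cst c) s0 (ltW t0)).
rewrite (itvint_eq _ (fun=> c))// itvint_cst ?lerDl ?ltW//.
by rewrite addrAC subrr add0r mulrCA mulVf ?mulr1// gt_eqF.
Qed.

(** The two windows of integration differ by two pieces of length [r]. Invariance of the limit
    measures follows as [t] grows. *)
Lemma tavg_theta f M z t r : continuous f -> (forall z, `|f z| <= M) -> 0 <= r -> 0 < t ->
  `|tavg T tau htau (f \o theta T tau htau r) z t - tavg T tau htau f z t| <= t^-1 * (2 * M * r).
Proof.
move=> cf HM r0 t0; have [x [s [-> s0 _]]] := susp_orbit_surj T tau htau cX ctau z.
have cfr : continuous (f \o theta T tau htau r).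
  by move=> u; apply: continuous_comp; [exact: theta_continuous|exact: cf].
have cF := orbit_fun_continuous f x cf.
rewrite !tavg_susp_orbit ?(ltW t0)//.
have -> : itvint (orbit_fun (f \o theta T tau htau r) x) s (s + t) =
    itvint (orbit_fun f x) (s + r) (s + r + t).
  rewrite -itvint_shift ?ltW//; last exact: orbit_fun_continuous.
  rewrite -[RHS]itvint_shift ?ltW//.
  apply: itvint_eq => u /andP[u0 _].
  by rewrite !orbit_fun_ge0 ?addr_ge0//= theta_susp_orbit ?addr_ge0// addrAC.
rewrite -mulrBr normrM gtr0_norm ?invr_gt0// ler_wpM2l ?invr_ge0 ?(ltW t0)//.
have b1 := itvint_cat _ s (s + r) (s + r + t) cF.
have b2 := itvint_cat _ s (s + t) (s + r + t) cF.
have E1 : itvint (orbit_fun f x) s (s + r + t) =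
  itvint (orbit_fun f x) s (s + r) + itvint (orbit_fun f x) (s + r) (s + r + t).
  by apply: b1; lra.
have E2 : itvint (orbit_fun f x) s (s + r + t) =
  itvint (orbit_fun f x) s (s + t) + itvint (orbit_fun f x) (s + t) (s + r + t).
  by apply: b2; lra.
have FM u : `|orbit_fun f x u| <= M by exact: HM.
have n1 := itvint_norm_le _ M s (s + r) cF; have n2 := itvint_norm_le _ M (s + t) (s + r + t) cF.
have {}n1 : `|itvint (orbit_fun f x) s (s + r)| <= M * (s + r - s) by apply: n1 => //; lra.
have {}n2 : `|itvint (orbit_fun f x) (s + t) (s + r + t)| <= M * (s + r + t - (s + t)).
  by apply: n2 => //; lra.
move: n1 n2; rewrite (_ : s + r - s = r); last by ring.
rewrite (_ : s + r + t - (s + t) = r); last by ring.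
rewrite !ler_norml => /andP[? ?] /andP[? ?]; apply/andP; split; lra.
Qed.

End SuspensionAverages.

(** * Invariant measures and limit measures *)

Section InvariantMeasures.
Context {R : realType} {X : pmetricType R} (T : X -> X) (tau : X -> R)
  (htau : forall x, 0 < tau x).
Local Notation K := (Xtau T tau htau).
Local Notation B := (borel_Xtau T tau htau).
Local Notation susp_orbit := (susp_orbit T tau htau).
Local Notation theta := (theta T tau htau).
Local Notation tavg := (tavg T tau htau).
Hypothesis cX : compact [set: X].
Hypothesis cT : continuous T.
Hypothesis ctau : continuous tau.
Implicit Type f : K -> R.

Let cK := Xtau_compact T tau htau cX ctau.
Let orbc f x := orbit_fun_continuous T tau htau cX cT ctau f x.

Lemma theta_measurable t : 0 <= t -> measurable_fun [set: B] (theta t : B -> B).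
Proof.
move=> t0; apply: (@measurability _ _ B B _ _ (@open K) erefl) => _ [A oA <-].
rewrite setTI; apply: sub_sigma_algebra.
by have /continuousP := theta_continuous T tau htau cX cT ctau t t0; apply.
Qed.

Lemma M_Theta_bint (nu : probability B R) f t :
  M_Theta T tau htau nu -> continuous f -> 0 <= t ->
  bint nu (f \o theta t) = bint nu f.
Proof.
move=> Hnu cf t0; have mt := theta_measurable t t0.
pose nut := measure_function_pushforward__canonical__measure_function_Measure nu mt.
rewrite /bint /Rintegral; congr fine.
have cft : continuous (f \o theta t).
  by move=> u; apply: continuous_comp; [exact: theta_continuous|exact: cf].
have <- : (\int[nut]_(y in [set: B]) (f y)%:E = \int[nu]_(y in [set: B]) (f y)%:E)%E.
  by apply: eq_measure_integral => A mA _; exact: Hnu.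
apply/esym; rewrite -[X in (\int[_]_(_ in X) _ = _)%E]/(theta t @^-1` [set: B]).
apply: (integral_pushforward mt (f := EFin \o f)) => //.
- by apply/measurable_EFinP; exact: continuous_measurable_borel.
- exact: continuous_integrable.
- by rewrite preimage_setT; exact: measurableT.
Qed.

Let theta_orbit x r t : 0 <= r -> 0 <= t -> theta t (susp_orbit x r) = susp_orbit x (r + t).
Proof. by move=> r0 t0; rewrite theta_susp_orbit. Qed.

(** By invariance [G], a sum of [N] translates of [f], has integral [N] times that of [f], so its
    maximum is at least that large. At a maximum point [z0] the time average over [N * d] differs
    from the Riemann sum by at most [e], which is the whole slack between the integral and [c]. *)
Lemma M_Theta_long_average (nu : probability B R) f (c A : R) :
  M_Theta T tau htau nu -> continuous f -> c < bint nu f ->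
  exists t z, [/\ A < t, 0 < t & c <= tavg f z t].
Proof.
move=> Hnu cf cnu; pose e := bint nu f - c.
have e0 : 0 < e by rewrite subr_gt0.
have [M M0 HM] := continuous_compact_ubound cX tau ctau.
have [d d0 Hd] := orbit_fun_modulus T tau htau cX cT ctau f M e cf e0.
have {}Hd z u : 0 <= u <= d -> `|f (theta u z) - f z| < e.
  move=> /andP[u0 ud]; have [x [s [-> s0 st]]] := susp_orbit_surj T tau htau cX ctau z.
  rewrite theta_orbit// -!orbit_fun_ge0 ?addr_ge0//; apply: Hd; rewrite ?u0//.
  by rewrite s0 (le_trans (ltW st))//; apply: le_trans (HM x); exact: ler_norm.
pose N := (Num.truncn (A / d)).+1.
have NA : A < N%:R * d by rewrite -ltr_pdivrMr// truncnS_gt.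
have kd0 (k : nat) : 0 <= k%:R * d by rewrite mulr_ge0// ltW.
have cth k : continuous (f \o theta (k%:R * d)).
  by move=> u; apply: continuous_comp; [exact: theta_continuous|exact: cf].
have [cG LG] := mean_sum _ (bint_mean cK nu) (fun k => f \o theta (k%:R * d)) N cth.
pose G z := \sum_(0 <= k < N) (f \o theta (k%:R * d)) z.
have bG : bint nu G = N%:R * bint nu f.
  rewrite /G LG (eq_bigr (fun=> bint nu f)); last by move=> k _; rewrite M_Theta_bint.
  by rewrite big_const_nat subn0 iter_addr_0 mulr_natl.
have [||z0 _ Hz0] := @compact_EVT_max K R G setT _ cK.
- by exists point.
- exact: continuous_subspaceT.
have Gz0 : N%:R * bint nu f <= G z0.
  rewrite -bG -[leRHS](mean_cst _ (bint_mean cK nu)).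
  apply: (bint_le cK) => //; first exact: continuous_cst.
  by move=> z; apply: Hz0; rewrite inE.
have N0 : 0 < N%:R * d by rewrite mulr_gt0// ltr0n.
exists (N%:R * d), z0; split=> //.
have [x [s [z0E s0 st]]] := susp_orbit_surj T tau htau cX ctau z0.
rewrite z0E (tavg_susp_orbit _ _ _ cX cT ctau)// ?(ltW N0)//.
have cF := orbc f x cf.
have riemann n : d * (\sum_(0 <= k < n) (f \o theta (k%:R * d)) z0) - n%:R * d * e <=
    itvint (orbit_fun T tau htau f x) s (s + n%:R * d).
  elim: n => [|n IH].
    by rewrite big_nil !mul0r mulr0 subr0 addr0 /itvint set_itv1 Rintegral_set1.
  rewrite big_nat_recr//= -natr1 mulrDl mul1r addrA.
  have sn : s <= s + n%:R * d by rewrite lerDl.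
  have sd : s + n%:R * d <= s + n%:R * d + d by rewrite lerDl ltW.
  rewrite (itvint_cat _ _ _ _ cF sn sd).
  have : `|itvint (orbit_fun T tau htau f x) (s + n%:R * d) (s + n%:R * d + d) -
      f (theta (n%:R * d) z0) * (s + n%:R * d + d - (s + n%:R * d))| <=
      e * (s + n%:R * d + d - (s + n%:R * d)).
    apply: itvint_dist => // u /andP[u1 u2].
    have u0 : 0 <= u - (s + n%:R * d) by rewrite subr_ge0.
    rewrite orbit_fun_ge0; last by apply: le_trans u1; rewrite addr_ge0.
    have -> : susp_orbit x u = theta (u - (s + n%:R * d)) (theta (n%:R * d) z0).
      rewrite z0E theta_orbit// theta_orbit//; last by rewrite addr_ge0.
      by rewrite addrC subrK.
    apply/ltW/Hd; rewrite u0/=; lra.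
  rewrite (_ : s + n%:R * d + d - (s + n%:R * d) = d); last by ring.
  rewrite ler_norml => /andP[H _]; move: IH H.
  move: (itvint _ _ _) (itvint _ _ _) (f _) (\sum_(_ <= _ < _) _) => I1 I2 v S.
  move: (n%:R * d) => y; nra.
rewrite ler_pdivlMl//; apply: le_trans (riemann N).
rewrite -/(G z0).
have : d * (N%:R * bint nu f) <= d * G z0 by rewrite ler_wpM2l// ltW.
rewrite /e; lra.
Qed.

Lemma birk_lin (g h : X -> R) (c : R) n x :
  birk T (fun x => g x - c * h x) n x = birk T g n x - c * birk T h n x.
Proof.
elim: n => [|n IH]; first by rewrite !birk0 mulr0 subrr.
by rewrite !birkS IH; ring.
Qed.

Local Notation roof_integral := (roof_integral T tau htau).

(** The segment is extended back to the base point below [z] and cut at its last return to the base.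
    Each end changes the integral by at most [D * M] and the duration changes by at most [M]; their
    total cost [C] does not depend on the length. *)
Lemma long_average_birk f (c w : R) (N0 : nat) : continuous f -> 0 < w ->
  (forall A, exists t z, [/\ A < t, 0 < t & c <= tavg f z t]) ->
  exists N y, (N0 <= N)%N /\
    - (w / 2 * N%:R) <= birk T (fun x => roof_integral f x - c * tau x) N y.
Proof.
move=> cf w0 Hc.
have [M M0 HM] := continuous_compact_ubound cX tau ctau.
have tM x : tau x <= M by apply: le_trans (ler_norm _) (HM x).
have [D D0 HD] := continuous_compact_ubound cK f cf.
pose C := 2 * (D * M) + `|c| * M.
have C0 : 0 <= C by rewrite addr_ge0// mulr_ge0// ?mulr_ge0// ltW.
(* [N1] makes [w / 2 * n] exceed [C]; a duration above [(N1 + 1) * M] forces at least [N1]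
   returns. *)
pose N1 := (N0 + (Num.truncn (C / (w / 2))).+1)%N.
have [t [z [At t0 Hz]]] := Hc (N1.+1%:R * M).
have [x [s [zE s0 st]]] := susp_orbit_surj T tau htau cX ctau z.
have [n /andP[n1 n2]] := birk_bracket T tau htau cX ctau x (s + t) (addr_ge0 s0 (ltW t0)).
have cF := orbc f x cf.
have FD u : `|orbit_fun T tau htau f x u| <= D by exact: HD.
have nN : (N1 <= n)%N.
  rewrite leqNgt; apply/negP => nN1.
  have H1 : birk T tau n.+1 x <= n.+1%:R * M.
    by apply: le_trans (ler_norm _) _; exact: birk_norm_le.
  have H2 : n.+1%:R * M <= N1.+1%:R * M by rewrite ler_pM2r// ler_nat ltnS ltnW.
  move: n2 At s0 H1 H2; lra.
exists n, x; split; first by apply: leq_trans nN; exact: leq_addr.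
rewrite birk_lin birk_roof_integral//.
have wn : C <= w / 2 * n%:R.
  have w20 : 0 < w / 2 by rewrite divr_gt0.
  rewrite mulrC -ler_pdivrMr//; apply: ltW; apply: lt_le_trans (truncnS_gt _) _.
  by rewrite ler_nat; apply: leq_trans nN; exact: leq_addl.
move: Hz; rewrite zE (tavg_susp_orbit _ _ _ cX cT ctau) ?(ltW t0)// ler_pdivlMl// => Hz.
have bS := birk_ge0 T tau htau n x.
have st' : s <= s + t by rewrite lerDl ltW.
have E1 := itvint_cat _ 0 s (s + t) cF s0 st'.
have E2 := itvint_cat _ 0 (birk T tau n x) (s + t) cF bS n1.
have b1 := itvint_norm_le _ D 0 s cF s0 FD.
have b2 := itvint_norm_le _ D (birk T tau n x) (s + t) cF n1 FD.
have n2' : s + t - birk T tau n x <= M.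
  by move: n2; rewrite birkS; have := tM (iter n T x); lra.
have sM : s <= M by apply: le_trans (ltW st) (tM x).
have b1' : D * (s - 0) <= D * M by rewrite ler_pM2l// subr0.
have b2' : D * (s + t - birk T tau n x) <= D * M by rewrite ler_pM2l.
have b3 : `|c * (birk T tau n x - t)| <= `|c| * M.
  by rewrite normrM ler_wpM2l// ler_norml; apply/andP; split; lra.
move: b1 b2 b3; rewrite !ler_norml => /andP[? ?] /andP[? ?] /andP[? ?].
move: wn; rewrite /C; lra.
Qed.

(** Since [N] returns take time at least [m * N], a defect of [e * m] per return is at most [e] per
    unit of time. *)
Lemma birk_average_tavg f (c e m : R) z N : continuous f -> 0 < m ->
  (forall x, m <= tau x) -> 0 <= e -> (0 < N)%N ->
  - (e * m * N%:R) <= birk T (fun x => roof_integral f x - c * tau x) N z ->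
  c - e <= tavg f (susp_orbit z 0) (birk T tau N z).
Proof.
move=> cf m0 mtau e0 N0; rewrite birk_lin birk_roof_integral// => H.
have Nm : N%:R * m <= birk T tau N z.
  rewrite /birk mulr_natl -[X in m *+ X](card_ord N) -sumr_const.
  by apply: ler_sum.
have S0 : 0 < birk T tau N z by apply: lt_le_trans Nm; rewrite mulr_gt0// ltr0n.
rewrite (tavg_susp_orbit _ _ _ cX cT ctau) ?(ltW S0)// add0r.
rewrite ler_pdivlMl//.
have : e * (N%:R * m) <= e * birk T tau N z by rewrite ler_wpM2l.
move: H; rewrite (mulrC _ (c - e)) mulrBl mulrAC -!mulrA; lra.
Qed.

Lemma common_oscillation (fs : 'I_3 -> K -> R) (cs : 'I_3 -> R) (e : R) :
  specification T -> (forall i, continuous (fs i)) -> 0 < e ->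
  (forall i, exists nu : probability B R, M_Theta T tau htau nu /\ cs i < bint nu (fs i)) ->
  exists z : K, forall i A, exists2 t, A < t & cs i - e <= tavg (fs i) z t.
Proof.
move=> spec cfs e0 Hnu.
have [m m0 mtau] := tau_lbound tau htau cX ctau.
(* The 3 cancels the factor of [specification_oscillation]; [m] turns a defect per return into one
   per unit of time. *)
pose w := e * m / 3.
have w0 : 0 < w by rewrite divr_gt0// mulr_gt0.
pose g i x := roof_integral (fs i) x - cs i * tau x.
have cg i : continuous (g i).
  rewrite (_ : g i = fun x => - cs i * tau x + roof_integral (fs i) x).
    apply: continuous_linr ctau _.
    exact: (roof_integral_continuous T tau htau cX cT ctau (fs i) (cfs i)).
  by apply/funext => x; rewrite /g addrC mulNr.
have Hy i n : exists y, - (w * n%:R) <= birk T (g i) n y.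
  apply: birk_all_lengths => // N0; apply: long_average_birk => // A.
  have [nu [Mnu cnu]] := Hnu i.
  exact: (M_Theta_long_average nu _ _ A Mnu (cfs i) cnu).
have [z Hz] := specification_oscillation T cX g w cT spec cg w0 Hy.
exists (susp_orbit z 0) => i A.
have [N0 HN0] := birk_unbounded T tau htau cX ctau A.
have [N N0N HN] := Hz i N0.
exists (birk T tau N z); first by apply: HN0; exact: ltnW.
apply: (birk_average_tavg (fs i) (cs i) e m z N (cfs i) m0 mtau (ltW e0)).
  exact: leq_ltn_trans N0N.
by move: HN; rewrite (_ : 3 * w = e * m)// /w; field.
Qed.

Lemma Xhat_large_average (Phi H : K -> R) (nu1 nu2 nu3 : probability B R) (c : R) :
  specification T -> continuous Phi -> continuous H ->
  M_Theta T tau htau nu1 -> M_Theta T tau htau nu2 -> M_Theta T tau htau nu3 ->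
  bint nu1 Phi < bint nu2 Phi -> c < bint nu3 H ->
  exists z, Xhat T tau htau Phi z /\ forall A, exists2 t, A < t & c <= tavg H z t.
Proof.
move=> spec cPhi cH M1 M2 M3; set p := bint nu1 Phi; set q := bint nu2 Phi => pq cH3.
(* The averages of [Phi] will fall to [p + 2 gap] and rise to [q - 2 gap] at arbitrarily late times.
   A limit within [gap] of both would give [q - p < 6 gap]. *)
pose gap := (q - p) / 8; pose gH := (bint nu3 H - c) / 2.
have gap0 : 0 < gap by rewrite divr_gt0// subr_gt0.
have gH0 : 0 < gH by rewrite divr_gt0// subr_gt0.
have cN : continuous (fun z => -1 * Phi z + 0).
  by apply: continuous_linr => //; exact: continuous_cst.
(* The third entry, for [H], is the default value of [nth]; likewise [c + gH] below. *)
pose fs (i : 'I_3) := nth H [:: (fun z => -1 * Phi z + 0); Phi] i.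
pose cs (i : 'I_3) := nth (c + gH) [:: - p - gap; q - gap] i.
have [||i|z Hz] := common_oscillation fs cs (Num.min gap gH) spec.
- by move=> [[|[|[|i]]]].
- by rewrite lt_min gap0.
- case: i => [[|[|[|//]]]] i3; rewrite /fs /cs /=.
  + exists nu1; split => //.
    have [lin _ _] := bint_mean cK nu1.
    rewrite lin//; last exact: continuous_cst.
    by rewrite (mean_cst _ (bint_mean cK nu1)) -/p; lra.
  + by exists nu2; split => //; rewrite -/q; lra.
  + by exists nu3; split => //; rewrite /gH; lra.
have mg : Num.min gap gH <= gap by rewrite ge_min lexx.
have mH : Num.min gap gH <= gH by rewrite ge_min lexx orbT.
exists z; split; last first.
  move=> A; have [t At] := Hz (@Ordinal 3 2 isT) A; rewrite /cs/fs/= => Ht.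
  by exists t => //; move: Ht; lra.
move=> [l /cvgrPdist_lt/(_ gap gap0)[A [_ HA]]].
have [t1] := Hz (@Ordinal 3 0 isT) (Num.max 0 A); rewrite gt_max /cs/fs/= => /andP[t10 At1].
have [t2] := Hz (@Ordinal 3 1 isT) (Num.max 0 A); rewrite gt_max /cs/fs/= => /andP[t20 At2].
have := HA _ At1; have := HA _ At2.
rewrite tavg_lin ?(ltW t10)//; last exact: continuous_cst.
rewrite tavg_cst// !ltr_norml => /andP[? ?] /andP[? ?] ? ?.
have : 8 * gap = q - p by rewrite /gap; field.
lra.
Qed.

End InvariantMeasures.

(** Compactness gives a cluster point, and along an ultrafilter a cluster point is a limit. *)
Lemma ultra_bounded_cvg {S : Type} {R : realType} (U : set_system S) (g : S -> R) (M : R) :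
  UltraFilter U -> (\forall t \near U, `|g t| <= M) -> exists l : R, g @ U --> l.
Proof.
move=> UU gM.
have cI : compact (`[-M, M]%classic : set R) by exact: segment_compact.
have gI : (g @ U) (`[-M, M]%classic).
  by apply: filterS gM => t /=; rewrite ler_norml in_itv.
have [l [_ lcl]] := cI (g @ U) _ gI.
exists l => V lV; have [//|nV] := in_ultra_setVsetC (g @^-1` V) UU.
have [x [nVx Vx]] := lcl (~` V) V nV lV.
by case: (nVx Vx).
Qed.

(** * Limit measures of one orbit and upper limits of its averages *)

Section LimitMeasures.
Context {R : realType} {X : pmetricType R} (T : X -> X) (tau : X -> R)
  (htau : forall x, 0 < tau x).
Local Notation K := (Xtau T tau htau).
Local Notation B := (borel_Xtau T tau htau).
Local Notation theta := (theta T tau htau).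
Local Notation tavg := (tavg T tau htau).
Hypothesis cX : compact [set: X].
Hypothesis cT : continuous T.
Hypothesis ctau : continuous tau.
Implicit Type f : K -> R.

Let cK := Xtau_compact T tau htau cX ctau.

Lemma Vlim_cvg (z : K) (nu : probability B R) : Vlim T tau htau z nu ->
  exists2 tn : nat -> R, tn @ \oo --> +oo &
    forall f, continuous f -> tavg f z (tn n) @[n --> \oo] --> bint nu f.
Proof.
move=> [tn [tny H]]; exists tn => // f cf.
have := H f cf; rewrite (bintE cK)//.
by move=> /fine_cvg.
Qed.

Lemma Vlim_M_Theta (z : K) (nu : probability B R) :
  Vlim T tau htau z nu -> M_Theta T tau htau nu.
Proof.
move=> /Vlim_cvg[tn tny H] r r0.
have cth := theta_continuous T tau htau cX cT ctau r r0.
apply: (bint_invariant_measure cK (Xtau_cozero T tau htau cX cT ctau)) => // f cf.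
have cfr : continuous (f \o theta r).
  by move=> u; apply: continuous_comp; [exact: cth|exact: cf].
have [M M0 HM] := continuous_compact_ubound cK f cf.
apply/eqP; rewrite -subr_eq0 -normr_le0; apply/ler_addgt0Pr => e e0; rewrite add0r.
have e3 : 0 < e / 3 by rewrite divr_gt0.
have /cvgrPdist_lt/(_ _ e3) H1 := H _ cfr.
have /cvgrPdist_lt/(_ _ e3) H2 := H _ cf.
have /cvgryPgt/(_ (Num.max 0 ((e / 3)^-1 * (2 * M * r)))) H3 := tny.
have [n [[n1 n2] n3]] := filter_ex (filterI (filterI H1 H2) H3).
move: n3; rewrite gt_max => /andP[t0 tC].
have H4 := tavg_theta T tau htau cX cT ctau f M z (tn n) r cf HM r0 t0.
have H5 : (tn n)^-1 * (2 * M * r) <= e / 3.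
  by rewrite ler_pdivrMl// [leRHS]mulrC -ler_pdivrMl// ltW.
move: n1 n2 (le_trans H4 H5).
move: (tavg (f \o theta r) z (tn n)) (tavg f z (tn n)) => a b.
rewrite !ltr_norml !ler_norml => /andP[? ?] /andP[? ?] /andP[? ?].
by apply/andP; split; lra.
Qed.

Lemma Vlim_exists (z : K) f0 (c : R) : continuous f0 ->
  (forall A, exists2 t, A < t & c <= tavg f0 z t) ->
  exists nu : probability B R, Vlim T tau htau z nu /\ c <= bint nu f0.
Proof.
move=> cf0 Hf0.
(* Only times whose average is at least [c] are kept, so the bound passes to the limit measure. The
   hypothesis says exactly that this filter is proper. *)
pose F : set_system R := within [set t | c <= tavg f0 z t] (pinfty_nbhs R).
have PF : ProperFilter F.
  split; last exact: within_filter.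
  move=> [A [Areal HA]]; have [t At ct] := Hf0 A.
  exact: (HA t At ct).
have [U [UU FU]] := ultraFilterLemma PF.
have UA (A : R) : U [set t | A < t].
  by apply: FU; exists A; split => //; exact: num_real.
have Uc : U [set t | c <= tavg f0 z t].
  by apply: FU; exists 0; split => // t _.
have bnd f : continuous f -> exists2 M : R, 0 < M & forall t, 0 < t -> `|tavg f z t| <= M.
  move=> cf; have [M M0 HM] := continuous_compact_ubound cK f cf.
  by exists M => // t t0; exact: tavg_norm_le.
have cvgU f : continuous f -> cvg (tavg f z @ U).
  move=> cf; have [M M0 HM] := bnd f cf.
  have [|l Hl] := ultra_bounded_cvg U (tavg f z) M UU.
    by apply: filterS (UA 0) => t; exact: HM.
  by apply/cvg_ex; exists l.
pose L f : R := lim (tavg f z @ U).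
have L_cvg f : continuous f -> tavg f z @ U --> L f by exact: cvgU.
have L_cst (k : R) : L (fun=> k) = k.
  apply/cvg_lim => //; apply: cvg_near_cst.
  by apply: filterS (UA 0) => t t0; rewrite tavg_cst.
have mL : mean_functional L.
  split=> [a f g cf cg|f g cf cg fg|]; last exact: L_cst.
    apply/cvg_lim => //.
    have H : (fun t => a * tavg f z t + tavg g z t) @ U --> a * L f + L g.
      by apply: cvgD; [apply: cvgMr; exact: L_cvg|exact: L_cvg].
    apply: cvg_trans H; apply: near_eq_cvg.
    by apply: filterS (UA 0) => t t0; rewrite tavg_lin// ltW.
  apply: (ler_cvg_to (L_cvg f cf) (L_cvg g cg)).
  by apply: filterS (UA 0) => t t0; apply: tavg_le => //; exact: ltW.
have [nu Hnu] := riesz_representation cK (Xtau_cozero T tau htau cX cT ctau) L mL.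
exists nu; split; last first.
  by rewrite Hnu//; apply: limr_ge Uc; exact: cvgU.
have [ee [cee dee]] := Xtau_separable T tau htau cX cT ctau.
(* A diagonal choice: sets of the ultrafilter are nonempty, so one time beyond [n] is good for the
   first [n + 1] functions of the dense family at once. *)
have /choice[tn Htn] : forall n : nat, exists t : R, n%:R < t /\
    forall i : 'I_n.+1, `|L (ee i) - tavg (ee i) z t| < n.+1%:R^-1.
  move=> n; have e0 : 0 < n.+1%:R^-1 :> R by rewrite invr_gt0.
  have H1 : \forall t \near U, forall i : 'I_n.+1, `|L (ee i) - tavg (ee i) z t| < n.+1%:R^-1.
    by apply: filter_forall => i; have /cvgrPdist_lt := L_cvg _ (cee i); apply.
  by have [t [t1 t2]] := filter_ex (filterI (UA n%:R) H1); exists t.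
exists tn; split.
  apply/cvgryPgt => A; near=> n; apply: lt_trans (proj1 (Htn n)).
  by near: n; exact: nbhs_infty_gtr.
move=> f cf; rewrite (bintE cK)//; apply: cvg_EFin; first exact: nearW.
rewrite Hnu//=; apply/cvgrPdist_le => e e0.
have e3 : 0 < e / 3 by rewrite divr_gt0.
have [i Hi] := dee f cf _ e3.
have ccf := continuous_linr (-1) f (ee i) cf (cee i).
(* Replacing [f] by a uniformly close [ee i] costs the same at all positive times, hence also in the
   limit [L]; convergence for the dense family then suffices. *)
have D1 t : 0 < t -> `|tavg f z t - tavg (ee i) z t| <= e / 3.
  move=> t0; have := tavg_norm_le T tau htau cX cT ctau (fun w => -1 * f w + ee i w) (e / 3) z t ccf.
  rewrite tavg_lin// ?(ltW t0)// mulN1r addrC distrC; apply => // w.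
  by rewrite mulN1r addrC distrC.
have D2 : `|L f - L (ee i)| <= e / 3.
  have cL : `|tavg f z t - tavg (ee i) z t| @[t --> U] --> `|L f - L (ee i)|.
    by apply: cvg_norm; apply: cvgB; exact: L_cvg.
  apply: (cvgr_to_le cL).
  by apply: filterS (UA 0) => t; exact: D1.
near=> n.
have ni : (i < n.+1)%N by near: n; exact: nbhs_infty_ge.
have ne : n.+1%:R^-1 < e / 3.
  rewrite invf_plt ?posrE//; near: n.
  have : \forall n \near \oo, (e / 3)^-1 < n%:R by exact: nbhs_infty_gtr.
  by apply: filterS => n /lt_trans; apply; rewrite ltr_nat.
have [tn0 Hn] := Htn n.
have {}Hn := Hn (Ordinal ni).
have t0 : 0 < tn n by apply: le_lt_trans tn0.
have := D1 _ t0; move: D2 (lt_trans Hn ne) => /=.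
move: (tavg f z (tn n)) (tavg (ee i) z (tn n)) => a b.
rewrite !ltr_norml !ler_norml => /andP[? ?] /andP[? ?] /andP[? ?].
by apply/andP; split; lra.
Unshelve. all: by end_near. Qed.

Lemma Vlim_frequently_le (z : K) (nu : probability B R) f (W : set R) (S : \bar R) :
  Vlim T tau htau z nu -> continuous f -> pinfty_nbhs R W ->
  (forall t, W t -> ((tavg f z t)%:E <= S)%E) -> ((bint nu f)%:E <= S)%E.
Proof.
move=> /Vlim_cvg[tn tny H] cf HW HS.
have Hn : \forall n \near \oo, ((tavg f z (tn n))%:E <= S)%E.
  have Hw : \forall n \near \oo, W (tn n) := tny _ HW.
  by apply: filterS Hw => n; exact: HS.
have Hc : (tavg f z (tn n))%:E @[n --> \oo] --> (bint nu f)%:E.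
  by apply: cvg_EFin; [exact: nearW|exact: H].
exact: (cvge_to_le Hc Hn).
Qed.

Lemma le_limf_esup_tavg (z : K) f (c : R) :
  (forall A, exists2 t, A < t & c <= tavg f z t) ->
  (c%:E <= limf_esup (fun t : R => (tavg f z t)%:E) +oo%R)%E.
Proof.
move=> Hf; rewrite limf_esupE; apply: le_ereal_inf_tmp => _ [W [A [_ HA]] <-].
have [t At ct] := Hf A.
apply: (@le_trans _ _ (tavg f z t)%:E); first by rewrite lee_fin.
by apply: ereal_sup_ubound; exists t => //; exact: HA.
Qed.

Lemma limf_esup_tavg_gt (z : K) f (c : R) :
  (c%:E < limf_esup (fun t : R => (tavg f z t)%:E) +oo%R)%E ->
  forall A, exists2 t, A < t & c <= tavg f z t.
Proof.
rewrite limf_esupE => Hc A.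
have : (c%:E < ereal_sup ((fun t : R => (tavg f z t)%:E) @` [set t | (A < t)%R]))%E.
  apply: lt_le_trans Hc _; apply: ereal_inf_lbound.
  by exists [set t | A < t] => //; exists A; split => //; exact: num_real.
by move=> /ereal_sup_gt[_ [t At <-]]; rewrite lte_fin => /ltW ct; exists t.
Qed.

(** Finiteness allows a small [e] to be subtracted from the upper limit, giving a real number
    strictly below it. *)
Lemma limf_esup_tavg_fin (z : K) f : continuous f ->
  limf_esup (fun t : R => (tavg f z t)%:E) +oo \is a fin_num.
Proof.
move=> cf; have [M M0 HM] := continuous_compact_ubound cK f cf.
have bnd t : 0 < t -> - M <= tavg f z t <= M.
  by move=> t0; rewrite -ler_norml; exact: tavg_norm_le.
rewrite fin_numElt; apply/andP; split.
  apply: (@lt_le_trans _ _ (- M)%:E); first exact: ltNyr.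
  apply: le_limf_esup_tavg => A; exists (Num.max 1 (A + 1)).
    by rewrite lt_max ltrDl ltr01 orbT.
  have m0 : 0 < Num.max 1 (A + 1) by rewrite lt_max ltr01.
  by have /andP[] := bnd _ m0.
apply: (@le_lt_trans _ _ M%:E); last exact: ltry.
rewrite limf_esupE; apply: (@le_trans _ _
  (ereal_sup ((fun t : R => (tavg f z t)%:E) @` [set t | (0 < t)%R]))).
  apply: ereal_inf_lbound.
  by exists [set t | 0 < t] => //; exists 0; split => //; exact: num_real.
by apply: ge_ereal_sup => _ [t t0 <-]; rewrite lee_fin; have /andP[] := bnd t t0.
Qed.

End LimitMeasures.


Theorem theorem5p2 (R : realType) (X : pmetricType R) (T : X -> X)
  (tau : X -> R) (htau : forall x, 0 < tau x)
  (Phi H : Xtau T tau htau -> R) :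
  compact [set: X] ->
  homeomorphism T ->
  specification T ->
  continuous tau ->
  continuous Phi -> continuous H ->
  (ereal_inf [set (\int[nu]_(y in [set: borel_Xtau T tau htau]) (Phi y)%:E)%E
              | nu in M_Theta T tau htau]
   < ereal_sup [set (\int[nu]_(y in [set: borel_Xtau T tau htau]) (Phi y)%:E)%E
              | nu in M_Theta T tau htau])%E ->
  ereal_sup [set (\int[nu]_(y in [set: borel_Xtau T tau htau]) (H y)%:E)%E
              | nu in M_Theta T tau htau]
  = ereal_sup [set (\int[nu]_(y in [set: borel_Xtau T tau htau]) (H y)%:E)%E
              | nu in \bigcup_(z in Xhat T tau htau Phi) Vlim T tau htau z]
  /\
  ereal_sup [set (\int[nu]_(y in [set: borel_Xtau T tau htau]) (H y)%:E)%E
              | nu in \bigcup_(z in Xhat T tau htau Phi) Vlim T tau htau z]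
  = ereal_sup [set limf_esup (fun t : R => (tavg T tau htau H z t)%:E) +oo
              | z in Xhat T tau htau Phi].
Proof.
move=> cX [cT _] spec ctau cPhi cH gap.
have cK := Xtau_compact T tau htau cX ctau.
set SM := ereal_sup [set _ | nu in M_Theta T tau htau].
set SV := ereal_sup [set _ | nu in \bigcup_(z in Xhat T tau htau Phi) _].
set SL := ereal_sup [set _ | z in Xhat T tau htau Phi].
(* Two invariant measures with strictly ordered [Phi]-integrals are what forces the glued orbit into
   [Xhat]. *)
have [_ [nu1 M1 <-] /ereal_sup_gt[_ [nu2 M2 <-]]] := ereal_inf_lt gap.
rewrite !(bintE cK)// lte_fin => nu12.
have VM : (SV <= SM)%E.
  apply: ereal_sup_le => _ [nu [z _ Vz] <-]; exists nu => //.
  exact: (Vlim_M_Theta T tau htau cX cT ctau z).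
(* The orbit depends on [nu3] and [e], but it always lies in [Xhat], so its upper limit counts in
   [SL]. *)
have ML : (SM <= SL)%E.
  apply: ge_ereal_sup => _ [nu3 M3 <-]; rewrite (bintE cK)//.
  apply/lee_addgt0Pr => e e0.
  have ce : bint nu3 H - e < bint nu3 H by rewrite ltrBlDr ltrDl.
  have [z [zX Hz]] := Xhat_large_average T tau htau cX cT ctau Phi H nu1 nu2 nu3 _
    spec cPhi cH M1 M2 M3 nu12 ce.
  rewrite -[bint nu3 H](subrK e) EFinD leeD2r//.
  apply: le_trans (le_limf_esup_tavg T tau htau z H _ Hz) _.
  by apply: ereal_sup_ubound; exists z.
have LV : (SL <= SV)%E.
  apply: ge_ereal_sup => _ [z zX <-]; set l := limf_esup _ _.
  have lfin : l \is a fin_num by exact: limf_esup_tavg_fin.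
  apply/lee_addgt0Pr => e e0.
  have le : ((fine l - e)%:E < l)%E.
    by rewrite -[X in (_ < X)%E](fineK lfin) lte_fin ltrBlDr ltrDl.
  have [nu [Vnu cnu]] := Vlim_exists T tau htau cX cT ctau z H _ cH
    (limf_esup_tavg_gt T tau htau z H _ le).
  rewrite -(fineK lfin) -[fine l](subrK e) EFinD leeD2r//.
  apply: (@le_trans _ _ (bint nu H)%:E); first by rewrite lee_fin.
  rewrite -(bintE cK)//; apply: ereal_sup_ubound; exists nu => //.
  by exists z.
have VL : (SV <= SL)%E.
  apply: ge_ereal_sup => _ [nu [z zX Vz] <-]; rewrite (bintE cK)//.
  apply: (@le_trans _ _ (limf_esup (fun t : R => (tavg T tau htau H z t)%:E) +oo)).
    rewrite limf_esupE; apply: le_ereal_inf_tmp => _ [W HW <-].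
    apply: (Vlim_frequently_le T tau htau cX ctau z nu H W _ Vz cH HW) => t Wt.
    by apply: ereal_sup_ubound; exists t.
  by apply: ereal_sup_ubound; exists z.
split; apply/eqP; rewrite eq_le.
  by rewrite VM (le_trans ML LV).
by rewrite VL LV.
Qed.
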